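(* Let $n\ge 1$, $m\in\mathbb{N}$, and let $\bar g=(g_1,\dots,g_m)$ be a tuple of polynomials in $\mathbb{R}[\bar X]$ such that $M(\bar g)$ is archimedean and $S(\bar g)\neq\emptyset$. Then there is a constant $c>0$ depending only on $\bar g$ such that for every $f\in\mathbb{R}[\bar X]$ there is a constant $c'>0$ (depending on $\bar g$ and $f$) with $$0\le f^*-f_k^*\le\frac{c'}{\sqrt[c]{\log\frac kc}}\qquad\text{for all sufficiently large }k\in\mathbb{N},$$ where $f^*:=\min\{f(x)\mid x\in S(\bar g)\}$ and $f_k^*:=\sup\{a\in\mathbb{R}\mid f-a\in M(\bar g,k)\}\in\mathbb{R}\cup\{-\infty\}$.
   Context: $\mathbb{N}=\{0,1,2,\dots\}$. $\mathbb{R}[\bar X]$ is the ring of real polynomials in $n\ge 1$ indeterminates $\bar X=(X_1,\dots,X_n)$, and $\sum\mathbb{R}[\bar X]^2$ is the set of (finite) sums of squares of polynomials in $\mathbb{R}[\bar X]$. For a tuple $\bar g=(g_1,\dots,g_m)$ of polynomials put $g_0:=1$ and $$S(\bar g):=\{x\in\mathbb{R}^n\mid g_1(x)\ge 0,\dots,g_m(x)\ge 0\},\qquad M(\bar g):=\left\{\sum_{i=0}^m\sigma_ig_i\;\middle|\;\sigma_i\in\sum\mathbb{R}[\bar X]^2\right\}.$$ $M(\bar g)$ is called the quadratic module generated by $\bar g$. It is archimedean if $N-\sum_{i=1}^nX_i^2\in M(\bar g)$ for some $N\in\mathbb{N}$ (in this case $S(\bar g)$ is compact). For real $k\ge 0$,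 $$M(\bar g,k):=\left\{\sum_{i=0}^m\sigma_ig_i\;\middle|\;\sigma_i\in\sum\mathbb{R}[\bar X]^2,\ \deg(\sigma_ig_i)\le k\text{ for all }i\right\}$$ (the zero polynomial satisfies every such degree bound; degree means total degree). $\log$ is the natural logarithm, and $\sqrt[c]{t}:=t^{1/c}$ for real $t>0$, $c>0$. *)

(* Defs.v *)
(* [mpoly] has to be imported before the analysis files: in the opposite order
   their notation levels clash. *)
From mathcomp Require Import all_boot all_order all_algebra.
From mathcomp Require Import mpoly.
From mathcomp Require Import classical_sets constructive_ereal reals ereal exp.

Set Implicit Arguments.
Unset Strict Implicit.
Unset Printing Implicit Defensive.

Import Order.TTheory GRing.Theory Num.Theory.

Local Open Scope ring_scope.
Local Open Scope classical_set_scope.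

Section QuadraticModule.
Variables (R : realType) (n m : nat).

Definition sos : set {mpoly R[n]} :=
  [set p | exists s : seq {mpoly R[n]}, p = \sum_(q <- s) q ^+ 2].

(* [msize p] is the total degree plus one, and [msize 0 = 0]; the truncated
   predecessor gives the zero polynomial degree [0], so that it satisfies every
   bound [tdeg p <= k] with [0 <= k]. *)
Definition tdeg (p : {mpoly R[n]}) : nat := (msize p).-1.

Variable g : m.-tuple {mpoly R[n]}.

(* [gext] is (g_0, g_1, ..., g_m) with g_0 = 1. *)
Definition gext : m.+1.-tuple {mpoly R[n]} := [tuple of 1 :: g].

Definition semialg_set : set 'rV[R]_n :=
  [set x | forall i : 'I_m, 0 <= (tnth g i).@[x 0]].

Definition quad_module : set {mpoly R[n]} :=
  [set p | exists sigma : 'I_m.+1 -> {mpoly R[n]},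
    (forall i, sos (sigma i)) /\ p = \sum_i sigma i * tnth gext i].

Definition quad_module_le (k : R) : set {mpoly R[n]} :=
  [set p | exists sigma : 'I_m.+1 -> {mpoly R[n]},
    [/\ forall i, sos (sigma i),
        forall i, (tdeg (sigma i * tnth gext i))%:R <= k
      & p = \sum_i sigma i * tnth gext i]].

Definition archimedean_qm : Prop :=
  exists N : nat, quad_module (N%:R - \sum_(i < n) 'X_i ^+ 2).

Definition is_min_on (A : set 'rV[R]_n) (f : {mpoly R[n]}) (v : R) : Prop :=
  (exists2 x, A x & f.@[x 0] = v) /\ (forall x, A x -> v <= f.@[x 0]).

(* The supremum is taken in the extended reals; it is [-oo] when no [a]
   qualifies. *)
Definition relax_opt (f : {mpoly R[n]}) (k : R) : \bar R :=
  ereal_sup [set a%:E | a in [set a : R | quad_module_le k (f - a%:MP)]].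

End QuadraticModule.

(* Main.v *)
Require Import Defs.
From mathcomp Require Import all_boot all_order all_algebra.
From mathcomp Require Import mpoly.
From mathcomp Require Import classical_sets constructive_ereal reals ereal exp.
From mathcomp Require Import boolp topology normedtype sequences derive.
From mathcomp Require Import ring lra.
From mathcomp Require ordered_qelim qe_rcf.
Import Order.TTheory GRing.Theory Num.Theory.
Import numFieldNormedType.Exports.
Set Implicit Arguments.
Unset Strict Implicit.
Unset Printing Implicit Defensive.
Local Open Scope ring_scope.
Local Open Scope classical_set_scope.

(** Fix [eps = 1 / u] with [u >= 1]. It suffices to write [f - fstar + eps] as an
    element of the quadratic module in which the degrees are at most
    [exp (C u^e)], with [e] independent of [f]: solving [k = exp (C u^e)] for
    [eps] gives an error of order [(log k)^(-1/e)].

    The archimedean hypothesis puts [N - |X|^2] into the module and confines the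
    feasible set to a cube. On the cube, subtract from [f - fstar + eps] a large
    multiple [lam] of the penalty [sum_i h_i (1 - h_i)^(2k)], where the [h_i] are
    the constraints scaled to [|h_i| <= 1]. This penalty lies in the quadratic
    module. It is at most of order [1 / k] where the constraints hold
    ([peak_le]), hence harmless once [k] is of order [lam u]. At a point where
    [f] is below [fstar - eps / 2], the Lipschitz continuity of [f] makes the
    distance to the feasible set at least of order [eps]; the Lojasiewicz
    inequality then says that some constraint is at most [- eps^(2L)] up to a
    constant, so that [lam] of order [u^(2L)] suffices to make the difference
    positive ([penalty_positive]).

    The difference is thus a polynomial [p >= eps / 4] on the cube. Its Bernstein
    coefficients of degree [K] are nonnegative as soon as [K] exceeds the
    absolute sum of its coefficients times the squared degree times [4 u]
    ([bernstein_certificate]), and the Bernstein polynomials are products of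
    affine functions [r + X_j] and [r - X_j] that lie in the quadratic module of
    [N - |X|^2]. The latter has one generator and is therefore closed under
    products ([principal_moduleM]), so [p] lies in it ([ball_certificate]). The
    power [(1 - h_i)^(2k)] makes the coefficients of [p], and with them [K],
    exponential in [k], which is of order [u^(2L+1)]; so [e = 2 L + 1].

    The Lojasiewicz inequality itself follows from Tarski's quantifier
    elimination ([definable_cusp], [lojasiewicz]): a semialgebraic condition on
    two parameters [0 < t], [0 < s] is constantly true or constantly false on a
    region [s < t^L] near the origin, because every polynomial in [(t, s)] has a
    constant sign on such a region. *)

(** * Semialgebraic predicates *)

Section Definable.
Variable R : rcfType.
Implicit Types (e : seq R) (u v : seq R -> R) (P Q : seq R -> Prop).

Definition polyfun u := exists t : GRing.term R, forall e, u e = GRing.eval e t.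

Definition definable P :=
  exists f : ordered_qelim.ord.formula R,
    forall e, P e <-> ordered_qelim.ord.holds e f.

Lemma polyfun_var i : polyfun (fun e => e`_i).
Proof. by exists (GRing.Var R i). Qed.

Lemma polyfun_const c : polyfun (fun=> c).
Proof. by exists (GRing.Const c). Qed.

Lemma polyfunD u v : polyfun u -> polyfun v -> polyfun (fun e => u e + v e).
Proof. by move=> [s us] [t vt]; exists (GRing.Add s t) => e /=; rewrite us vt. Qed.

Lemma polyfunN u : polyfun u -> polyfun (fun e => - u e).
Proof. by move=> [s us]; exists (GRing.Opp s) => e /=; rewrite us. Qed.

Lemma polyfunM u v : polyfun u -> polyfun v -> polyfun (fun e => u e * v e).
Proof. by move=> [s us] [t vt]; exists (GRing.Mul s t) => e /=; rewrite us vt. Qed.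

Lemma polyfunX u k : polyfun u -> polyfun (fun e => u e ^+ k).
Proof. by move=> [s us]; exists (GRing.Exp s k) => e /=; rewrite us. Qed.

Lemma polyfun_sum (I : Type) (r : seq I) (F : I -> seq R -> R) :
  (forall i, polyfun (F i)) -> polyfun (fun e => \sum_(i <- r) F i e).
Proof.
move=> polyF; elim: r => [|i r [s us]].
  by exists (GRing.Const 0) => e; rewrite big_nil.
have [t vt] := polyF i.
by exists (GRing.Add t s) => e; rewrite big_cons /= us vt.
Qed.

Lemma polyfun_prod (I : Type) (r : seq I) (F : I -> seq R -> R) :
  (forall i, polyfun (F i)) -> polyfun (fun e => \prod_(i <- r) F i e).
Proof.
move=> polyF; elim: r => [|i r [s us]].
  by exists (GRing.Const 1) => e; rewrite big_nil.
have [t vt] := polyF i.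
by exists (GRing.Mul t s) => e; rewrite big_cons /= us vt.
Qed.

Lemma polyfun_meval n (p : {mpoly R[n]}) (F : 'I_n -> seq R -> R) :
  (forall i, polyfun (F i)) -> polyfun (fun e => p.@[fun i => F i e]).
Proof.
move=> polyF; have [t tP] : polyfun (fun e =>
    \sum_(m <- msupp p) p@_m * \prod_(i < n) F i e ^+ m i).
  apply: polyfun_sum => m; apply: polyfunM; first exact: polyfun_const.
  by apply: polyfun_prod => i; apply: polyfunX.
by exists t => e; rewrite -tP mevalE.
Qed.

Lemma definable_le u v : polyfun u -> polyfun v -> definable (fun e => u e <= v e).
Proof.
move=> [s us] [t vt]; exists (ordered_qelim.ord.Le s t) => e /=.
by rewrite us vt.
Qed.

Lemma definable_not P : definable P -> definable (fun e => ~ P e).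
Proof.
move=> [f Pf]; exists (ordered_qelim.ord.Not f) => e /=.
by have := Pf e; tauto.
Qed.

Lemma definable_and P Q :
  definable P -> definable Q -> definable (fun e => P e /\ Q e).
Proof.
move=> [f Pf] [h Qh]; exists (ordered_qelim.ord.And f h) => e /=.
by have := Pf e; have := Qh e; tauto.
Qed.

Lemma definable_forall_fin m (P : 'I_m -> seq R -> Prop) :
  (forall i, definable (P i)) -> definable (fun e => forall i, P i e).
Proof.
elim: m P => [|m IHm] P defP.
  by exists (ordered_qelim.ord.Bool true) => e; split=> // _ [].
have [f fP] := IHm _ (fun i => defP (lift ord0 i)).
have [h hP] := defP ord0.
exists (ordered_qelim.ord.And h f) => e /=; rewrite -fP -hP.
split=> [Pe|[P0 PS] i]; first by split.
by case: (unliftP ord0 i) => [j|] ->.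
Qed.

Lemma definable_env P e e' :
  definable P -> (forall j, e'`_j = e`_j) -> P e -> P e'.
Proof.
move=> [f fP] ee' /fP fe; apply/fP; apply: ordered_qelim.ord.eq_holds fe.
by move=> j; rewrite ee'.
Qed.

(** A point of the space occupies a block of consecutive entries of an
    environment; quantifying over it means quantifying over the environments that
    agree outside the block. *)
Lemma definable_exists_block off k P : definable P ->
  definable (fun e => exists e',
    (forall j, (j < off)%N || (off + k <= j)%N -> e'`_j = e`_j) /\ P e').
Proof.
move=> defP; elim: k => [|k [f fP]].
  have [f fP] := defP; exists f => e; rewrite -fP.
  split=> [[e' [ee' Pe']]|Pe]; last by exists e.
  apply: definable_env defP _ Pe' => j.
  by rewrite ee' // addn0 orbC; case: leqP.
exists (ordered_qelim.ord.Exists (off + k) f) => e /=; split.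
  move=> [e' [ee' Pe']]; exists e'`_(off + k); apply/fP; exists e'; split=> // j.
  rewrite nth_set_nth /=; case: eqP => [->//|/eqP nj jP]; apply: ee'.
  by move: jP; rewrite (leq_eqVlt (off + k)) eq_sym (negPf nj) addnS.
move=> [x /fP[e' [ee' Pe']]]; exists e'; split=> // j.
rewrite addnS => jP; rewrite ee'; last first.
  by case/orP: jP => [->//|/ltnW ->]; rewrite orbT.
rewrite nth_set_nth /=; case: eqP => // jE; move: jP.
by rewrite jE ltnn orbF ltnNge leq_addr.
Qed.

(** Tarski's theorem, in the form in which it is used: the eliminated formula
    has no quantifier and its terms contain no inverse, so they are
    polynomials. *)
Lemma definable_qf P : definable P -> exists2 q : ordered_qelim.ord.formula R,
  ordered_qelim.ord.qf_form q && ordered_qelim.ord.rformula q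
  & forall e, P e <-> ordered_qelim.ord.qf_eval e q.
Proof.
move=> [f fP].
exists (ordered_qelim.ord.quantifier_elim
          (fun i bc => qe_rcf.qfr_to_formula (@qe_rcf.wproj R i bc))
          (ordered_qelim.ord.to_rform f)).
  apply: ordered_qelim.ord.quantifier_elim_wf.
    by move=> i bc /=; apply: qe_rcf.wf_QE_wproj.
  exact: ordered_qelim.ord.to_rform_rformula.
move=> e; rewrite fP; apply: rwP; exact: qe_rcf.rcf_satP.
Qed.

(** * Signs near the origin *)

(** For [r0 <= 1] these regions shrink when [L] grows or [r0] decreases, so any
    two of them contain a third. *)
Definition cusp (L : nat) (r0 t s : R) : Prop :=
  [/\ 0 < t, t < r0, 0 < s & s < t ^+ L].

Definition ult_cusp (P : R -> R -> Prop) : Prop :=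
  exists L r0, [/\ 0 < r0, r0 <= 1 & forall t s, cusp L r0 t s -> P t s].

Lemma ult_cuspI (P Q T : R -> R -> Prop) :
  (forall t s, P t s -> Q t s -> T t s) ->
  ult_cusp P -> ult_cusp Q -> ult_cusp T.
Proof.
move=> PQT [L [r [r_gt0 r_le1 Pr]]] [L' [r' [r'_gt0 r'_le1 Qr']]].
exists (maxn L L'), (Num.min r r').
rewrite lt_min r_gt0 r'_gt0 ge_min r_le1; split=> // t s [t_gt0].
rewrite lt_min => /andP[tr tr'] s_gt0 st.
have t01 : 0 <= t <= 1 by rewrite (ltW t_gt0) (ltW (lt_le_trans tr r_le1)).
apply: PQT; [apply: Pr|apply: Qr']; split=> //; apply: lt_le_trans st _.
  by apply: ler_wiXn2l; rewrite ?leq_maxl//; case/andP: t01.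
by apply: ler_wiXn2l; rewrite ?leq_maxr//; case/andP: t01.
Qed.

Lemma ult_cusp1 (P Q : R -> R -> Prop) :
  (forall t s, 0 < t < 1 -> 0 < s < 1 -> P t s -> Q t s) ->
  ult_cusp P -> ult_cusp Q.
Proof.
move=> PQ [L [r [r_gt0 r_le1 Pr]]]; exists L, r; split=> // t s ts.
have [t_gt0 tr s_gt0 st] := ts.
have t1 := lt_le_trans tr r_le1.
apply: PQ (Pr _ _ ts); first by rewrite t_gt0.
by rewrite s_gt0 (lt_le_trans st) // exprn_ile1 // ltW.
Qed.

Lemma ult_cuspT (P : R -> R -> Prop) : (forall t s, P t s) -> ult_cusp P.
Proof. by move=> PT; exists 0%N, 1; split. Qed.

Lemma sgrD_small (x y : R) : `|y| < `|x| -> Num.sg (x + y) = Num.sg x.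
Proof.
have [x_gt0|x_lt0|->] := ltrgt0P x; last by rewrite ltNge normr_ge0.
  by rewrite ltr_norml => /andP[xy _]; rewrite !gtr0_sg // -ltrBlDl sub0r.
by rewrite ltr_norml => /andP[_ xy]; rewrite !ltr0_sg // -ltrBrDl sub0r.
Qed.

Lemma poly_bound01 (c : {poly R}) :
  exists2 M, 0 < M & forall t, 0 < t < 1 -> `|c.[t]| <= M.
Proof.
elim/poly_ind: c => [|c d [M M_gt0 Mc]].
  by exists 1 => // t _; rewrite horner0 normr0.
exists (M + `|d|); first by rewrite ltr_wpDr.
move=> t t01; rewrite hornerMXaddC (le_trans (ler_normD _ _)) // lerD2r.
rewrite normrM -[M]mulr1 ler_pM ?Mc //.
by case/andP: t01 => t0 t1; rewrite gtr0_norm // ltW.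
Qed.

(** The sign is that of the lowest nonzero coefficient. *)
Lemma poly_sign_near0 (c : {poly R}) : c != 0 -> exists a r0 sg,
  [/\ 0 < r0, r0 <= 1 & forall t, 0 < t < r0 ->
      Num.sg c.[t] = sg /\ t ^+ a <= `|c.[t]|].
Proof.
elim/poly_ind: c => [|c d IHc]; first by rewrite eqxx.
have [->{d}|d_neq0] := eqVneq d 0.
  rewrite addr0 mulf_eq0 polyX_eq0 orbF => /IHc[a [r [sg [r_gt0 r_le1 rP]]]].
  exists a.+1, r, sg; split=> // t /[dup] t0r /rP[sgE le_c].
  have /andP[t_gt0 _] := t0r.
  rewrite hornerMX sgrM (gtr0_sg t_gt0) mulr1 normrM (gtr0_norm t_gt0).
  by rewrite exprSr ler_pM2r.
move=> _; have [M M_gt0 Mc] := poly_bound01 c.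
have nd_gt0 : 0 < `|d| by rewrite normr_gt0.
exists 1%N, (Num.min 1 (`|d| / (M + 1))), (Num.sg d).
have r_gt0 : 0 < Num.min 1 (`|d| / (M + 1)).
  by rewrite lt_min ltr01 divr_gt0 // addr_gt0.
split=> //; first by rewrite ge_min lexx.
move=> t /andP[t_gt0]; rewrite lt_min => /andP[t_lt1].
rewrite ltr_pdivlMr ?addr_gt0 // mulrDr mulr1 => t_small.
have cX : `|c.[t] * t| <= t * M.
  rewrite normrM (gtr0_norm t_gt0) mulrC ler_pM2l //.
  by apply: Mc; rewrite t_gt0.
rewrite hornerMXaddC expr1 addrC; split.
  apply: sgrD_small; apply: le_lt_trans cX _.
  by rewrite (lt_trans _ t_small) // ltrDl.
rewrite -[c.[t] * t]opprK (le_trans _ (lerB_dist _ _)) // normrN.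
by rewrite lerBrDr (le_trans _ (ltW t_small)) // addrC lerD2r.
Qed.

Lemma poly2_bound01 (p : {poly {poly R}}) :
  exists2 M, 0 < M & forall t s, 0 < t < 1 -> 0 < s < 1 -> `|p.[s%:P].[t]| <= M.
Proof.
elim/poly_ind: p => [|p d [M M_gt0 Mp]].
  by exists 1 => // t s _ _; rewrite !horner0 normr0.
have [M' M'_gt0 M'd] := poly_bound01 d.
exists (M + M'); first by rewrite addr_gt0.
move=> t s t01 s01; rewrite hornerMXaddC hornerD hornerM hornerC.
rewrite (le_trans (ler_normD _ _)) // lerD ?M'd //.
rewrite normrM -[M]mulr1 ler_pM ?Mp //.
by case/andP: s01 => s0 s1; rewrite gtr0_norm // ltW.
Qed.

(** On a thin cusp [s] is smaller than any given power of [t]. Hence the lowest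
    nonzero coefficient, as a polynomial in [s], decides the sign: it is itself
    bounded below by a power of [t], by [poly_sign_near0]. *)
Lemma poly2_sign_cusp (p : {poly {poly R}}) :
  exists sg, ult_cusp (fun t s => Num.sg p.[s%:P].[t] = sg).
Proof.
elim/poly_ind: p => [|p d [sg IHp]].
  by exists 0; apply: ult_cuspT => t s; rewrite !horner0 sgr0.
have [->{d}|/poly_sign_near0[a [r [sg' [r_gt0 r_le1 rP]]]]] := eqVneq d 0.
  exists sg; apply: ult_cusp1 IHp => t s _ /andP[s_gt0 _] <-.
  by rewrite addr0 hornerMX hornerM hornerC sgrM (gtr0_sg s_gt0) mulr1.
have [M M_gt0 Mp] := poly2_bound01 p.
exists sg', a.+1, (Num.min r M^-1).
have rM_gt0 : 0 < Num.min r M^-1 by rewrite lt_min r_gt0 invr_gt0.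
split=> //; first by rewrite ge_min r_le1.
move=> t s [t_gt0]; rewrite lt_min => /andP[t_ltr t_ltM] s_gt0 s_lt.
have t_lt1 := lt_le_trans t_ltr r_le1.
have s_lt1 : s < 1 by rewrite (lt_le_trans s_lt) // exprn_ile1 // ltW.
have [|<- c_ge] := rP t; first by rewrite t_gt0.
rewrite hornerMXaddC hornerD hornerM hornerC addrC; apply: sgrD_small.
apply: lt_le_trans c_ge; rewrite normrM (gtr0_norm s_gt0).
apply: le_lt_trans (_ : M * s < _).
  by rewrite ler_pM2r // Mp ?t_gt0 ?s_gt0.
rewrite mulrC -ltr_pdivlMr //; apply: lt_trans s_lt _.
by rewrite exprSr ltr_pM2l ?exprn_gt0.
Qed.

(** Variables other than the first two read the default value [0] of the
    environment. *)
Lemma rterm_poly2 (t : GRing.term R) : GRing.rterm t ->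
  exists p : {poly {poly R}}, forall x y, GRing.eval [:: x; y] t = p.[y%:P].[x].
Proof.
elim: t => //=.
- move=> [|[|i]] _; [exists ('X%:P)|exists 'X|exists 0] => x y.
  + by rewrite hornerC hornerX.
  + by rewrite hornerX hornerC.
  + by rewrite !horner0 /= nth_nil.
- by move=> c _; exists c%:P%:P => x y; rewrite !hornerC.
- by move=> k _; exists k%:R%:P%:P => x y; rewrite !hornerC.
- move=> s IHs t IHt /andP[/IHs[p ps] /IHt[q qt]]; exists (p + q) => x y.
  by rewrite !hornerD ps qt.
- by move=> s IHs /IHs[p ps]; exists (- p) => x y; rewrite !hornerN ps.
- by move=> s IHs k /IHs[p ps]; exists (p *+ k) => x y; rewrite !hornerMn ps.
- move=> s IHs t IHt /andP[/IHs[p ps] /IHt[q qt]]; exists (p * q) => x y.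
  by rewrite !hornerM ps qt.
- by move=> s IHs k /IHs[p ps]; exists (p ^+ k) => x y; rewrite !horner_exp ps.
Qed.

Lemma term_sign_cusp (s t : GRing.term R) : GRing.rterm s && GRing.rterm t ->
  exists sg, ult_cusp (fun x y =>
    Num.sg (GRing.eval [:: x; y] s - GRing.eval [:: x; y] t) = sg).
Proof.
move=> /andP[/rterm_poly2[p ps] /rterm_poly2[q qt]].
have [sg [L [r [r0 r1 rP]]]] := poly2_sign_cusp (p - q).
exists sg, L, r; split=> // x y xy.
by rewrite ps qt -(rP _ _ xy) !hornerD !hornerN.
Qed.

(** Every polynomial has constant sign on a thin enough cusp, hence so has every
    Boolean combination of sign conditions. *)
Lemma qf_cusp (q : ordered_qelim.ord.formula R) :
  ordered_qelim.ord.qf_form q && ordered_qelim.ord.rformula q ->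
  exists b, ult_cusp (fun t s => ordered_qelim.ord.qf_eval [:: t; s] q = b).
Proof.
elim: q => //=.
- by move=> b _; exists b; apply: ult_cuspT.
- move=> s t st; have [sg sgP] := term_sign_cusp st; exists (sg == 0).
  by apply: ult_cusp1 sgP => x y _ _ <-; rewrite sgr_eq0 subr_eq0.
- move=> s t st; have [sg sgP] := term_sign_cusp st; exists (sg < 0).
  by apply: ult_cusp1 sgP => x y _ _ <-; rewrite sgr_lt0 subr_lt0.
- move=> s t st; have [sg sgP] := term_sign_cusp st; exists (sg <= 0).
  by apply: ult_cusp1 sgP => x y _ _ <-; rewrite sgr_le0 subr_le0.
- move=> f IHf h IHh /andP[/andP[qf qh] /andP[rf rh]].
  have [|b Pb] := IHf; first by rewrite qf.
  have [|c Pc] := IHh; first by rewrite qh.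
  by exists (b && c); apply: ult_cuspI Pb Pc => t s -> ->.
- move=> f IHf h IHh /andP[/andP[qf qh] /andP[rf rh]].
  have [|b Pb] := IHf; first by rewrite qf.
  have [|c Pc] := IHh; first by rewrite qh.
  by exists (b || c); apply: ult_cuspI Pb Pc => t s -> ->.
- move=> f IHf h IHh /andP[/andP[qf qh] /andP[rf rh]].
  have [|b Pb] := IHf; first by rewrite qf.
  have [|c Pc] := IHh; first by rewrite qh.
  by exists (b ==> c); apply: ult_cuspI Pb Pc => t s -> ->.
- move=> f IHf /IHf[b Pb]; exists (~~ b).
  by apply: ult_cusp1 Pb => t s _ _ ->.
Qed.

Lemma definable_cusp P : definable P ->
  ult_cusp (fun t s => P [:: t; s]) \/ ult_cusp (fun t s => ~ P [:: t; s]).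
Proof.
move=> /definable_qf[q /qf_cusp[b Pb] qP]; case: b Pb => Pb; [left|right].
  by apply: ult_cusp1 Pb => t s _ _ /qP.
by apply: ult_cusp1 Pb => t s _ _ qF /qP; rewrite qF.
Qed.

End Definable.

(** * Polynomials on a cube *)

Section Cube.
Variables (R : realType) (n : nat).
Implicit Types (p q : {mpoly R[n]}).

Lemma mpoly_ring_ind (K : {mpoly R[n]} -> Prop) :
  (forall c, K c%:MP) -> (forall i, K 'X_i) ->
  (forall p q, K p -> K q -> K (p + q)) ->
  (forall p q, K p -> K q -> K (p * q)) -> forall p, K p.
Proof.
move=> KC KX KD KM p; rewrite [p]mpolyE.
have K0 : K 0 by rewrite -mpolyC0.
elim/big_ind: _ => // m _; rewrite -mul_mpolyC; apply: (KM) => //.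
rewrite mpolyXE_id; elim/big_ind: _ => [|//|i _]; first by rewrite -mpolyC1.
elim: (m i) => [|k IHk]; first by rewrite expr0 -mpolyC1.
by rewrite exprS; apply: KM.
Qed.

(** The Lipschitz constant of a product depends on bounds for its factors, so both
    constants come from one induction. *)
Lemma meval_cube_lip (r : R) p : exists2 F, 0 < F &
  forall x : 'I_n -> R, (forall i, `|x i| <= r) -> `|p.@[x]| <= F /\
    forall y d, (forall i, `|y i| <= r) -> (forall i, `|x i - y i| <= d) ->
      0 <= d -> `|p.@[x] - p.@[y]| <= F * d.
Proof.
elim/mpoly_ring_ind: p => [c|i|p q [F F0 FP] [G G0 GP]|p q [F F0 FP] [G G0 GP]].
- exists (`|c| + 1); first by rewrite ltr_wpDl.
  move=> x _; rewrite mevalC lerDl; split=> // y d _ _ d0.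
  by rewrite mevalC subrr normr0 mulr_ge0 // addr_ge0.
- exists (`|r| + 1); first by rewrite ltr_wpDl.
  move=> x xr; rewrite mevalXU; split=> [|y d _ xyd d0].
    by rewrite (le_trans (xr i)) // (le_trans (ler_norm r)) // lerDl.
  by rewrite mevalXU (le_trans (xyd i)) // ler_peMl // lerDr.
- exists (F + G); first exact: addr_gt0.
  move=> x xr; have [Fx FL] := FP _ xr; have [Gx GL] := GP _ xr.
  rewrite mevalD; split=> [|y d yr xyd d0].
    by rewrite (le_trans (ler_normD _ _)) // lerD.
  have := FL y d yr xyd d0; have := GL y d yr xyd d0; rewrite mevalD.
  have -> : p.@[x] + q.@[x] - (p.@[y] + q.@[y]) =
            p.@[x] - p.@[y] + (q.@[x] - q.@[y]) by ring.
  by move=> Gd Fd; rewrite (le_trans (ler_normD _ _)) // mulrDl lerD.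
- exists (F * G + F * G); first by rewrite addr_gt0 // mulr_gt0.
  move=> x xr; have [Fx FL] := FP _ xr; have [Gx GL] := GP _ xr.
  rewrite mevalM; split=> [|y d yr xyd d0].
    by rewrite normrM (@le_trans _ _ (F * G)) ?ler_pM // lerDl mulr_ge0 // ltW.
  have := FL y d yr xyd d0; have := GL y d yr xyd d0; rewrite mevalM.
  have [Gy _] := GP _ yr; move=> Gd Fd.
  have -> : p.@[x] * q.@[x] - p.@[y] * q.@[y] =
            p.@[x] * (q.@[x] - q.@[y]) + (p.@[x] - p.@[y]) * q.@[y] by ring.
  rewrite (le_trans (ler_normD _ _)) // [leRHS]mulrDl !normrM lerD //.
    by rewrite -mulrA ler_pM.
  by rewrite mulrAC ler_pM.
Qed.

Lemma meval_continuous p : continuous (fun x : 'rV[R]_n => p.@[x 0]).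
Proof.
move=> x; elim/mpoly_ring_ind: p => [c|i|p q Pp Pq|p q Pp Pq].
- have -> : (fun x : 'rV[R]_n => c%:MP.@[x 0]) = (fun=> c).
    by apply/funext => y; rewrite mevalC.
  exact: cst_continuous.
- have -> : (fun x : 'rV[R]_n => ('X_i : {mpoly R[n]}).@[x 0]) = (fun x => x 0 i).
    by apply/funext => y; rewrite mevalXU.
  exact: coord_continuous.
- have -> : (fun x : 'rV[R]_n => (p + q).@[x 0]) = (fun x => p.@[x 0] + q.@[x 0]).
    by apply/funext => y; rewrite mevalD.
  exact: continuousD.
- have -> : (fun x : 'rV[R]_n => (p * q).@[x 0]) = (fun x => p.@[x 0] * q.@[x 0]).
    by apply/funext => y; rewrite mevalM.
  exact: continuousM.
Qed.

Lemma cube_compact (r : R) :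
  compact [set x : 'rV[R]_n | forall i, `|x 0 i| <= r].
Proof.
have := @rV_compact R n (fun=> `[- r, r]%classic) (fun=> @segment_compact _ _ _).
congr compact; apply/seteqP; split=> x /= xr i; have := xr i.
  by rewrite in_itv /= ler_norml.
by rewrite ler_norml in_itv.
Qed.

Lemma semialg_set_closed m (g : m.-tuple {mpoly R[n]}) : closed (semialg_set g).
Proof.
have -> : semialg_set g = \bigcap_(i in setT) [set x | 0 <= (tnth g i).@[x 0]].
  by apply/seteqP; split=> x xS i; [move=> _|]; apply: xS.
apply: closed_bigI => i _.
apply: (@closed_comp _ _ (fun x : 'rV[R]_n => (tnth g i).@[x 0]) [set v | 0 <= v]).
  by move=> x _; apply: meval_continuous.
exact: closed_ge.
Qed.

End Cube.

(** * The Lojasiewicz inequality *)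

Section Lojasiewicz.
Variables (R : realType) (n m : nat) (g : m.-tuple {mpoly R[n]}) (r : R).

(** Such points contradict the Lojasiewicz inequality when [s] is small compared
    with [t]. *)
Definition far_almost (t s : R) (x : 'rV[R]_n) : Prop :=
  [/\ forall i, `|x 0 i| <= r,
      forall i, - s <= (tnth g i).@[x 0]
    & forall y : 'rV[R]_n, semialg_set g y ->
        t <= \sum_i (x 0 i - y 0 i) ^+ 2].

Lemma env_update (e : seq R) off (v : 'I_n -> R) : exists e',
  (forall j, (j < off)%N || (off + n <= j)%N -> e'`_j = e`_j) /\
  forall i : 'I_n, e'`_(off + i) = v i.
Proof.
pose F j := if (j < off)%N then e`_j else
  if insub (j - off)%N is Some i then v i else e`_j.
exists (mkseq F (maxn (size e) (off + n))); split=> [j jP|i].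
  have [jlt|jge] := ltnP j (maxn (size e) (off + n)); last first.
    by rewrite !nth_default ?size_mkseq // (leq_trans _ jge) // leq_maxl.
  rewrite nth_mkseq // /F; case: ltnP jP => //= offj offnj.
  by rewrite insubF //; apply/negP; rewrite ltn_subLR // ltnNge offnj.
rewrite nth_mkseq; last by rewrite (leq_trans _ (leq_maxr _ _)) // ltn_add2l.
by rewrite /F ltnNge leq_addr /= addKn valK.
Qed.

(** The environment holds [t], [s], then the coordinates of [x], then those of
    [y]. *)
Lemma far_almost_definable : exists P : seq R -> Prop,
  definable P /\ forall t s, P [:: t; s] <-> exists x, far_almost t s x.
Proof.
pose x (e : seq R) := fun i : 'I_n => e`_(2 + i).
pose y (e : seq R) := fun i : 'I_n => e`_(2 + n + i).
pose agree off (e' e : seq R) :=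
  forall j, (j < off)%N || (off + n <= j)%N -> e'`_j = e`_j.
pose Q e := (forall i, 0 <= (tnth g i).@[y e]) /\
  ~ (e`_0 <= \sum_i (x e i - y e i) ^+ 2).
pose P e := ((forall i, - r <= x e i) /\ (forall i, x e i <= r)) /\
  ((forall i, - e`_1 <= (tnth g i).@[x e]) /\
   ~ exists e', agree (2 + n)%N e' e /\ Q e').
have polyx i : polyfun (fun e => x e i) by apply: polyfun_var.
have polyy i : polyfun (fun e => y e i) by apply: polyfun_var.
have defQ : definable Q.
  apply: definable_and.
    apply: definable_forall_fin => i; apply: definable_le.
      exact: polyfun_const.
    exact: polyfun_meval.
  apply/definable_not/definable_le; first exact: polyfun_var.
  apply: polyfun_sum => i; apply: polyfunX; apply: polyfunD => //.
  exact: polyfunN.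
have defP : definable P.
  apply: definable_and.
    by apply: definable_and; apply: definable_forall_fin => i;
      apply: definable_le => //; apply: polyfun_const.
  apply: definable_and.
    apply: definable_forall_fin => i; apply: definable_le.
      exact/polyfunN/polyfun_var.
    exact: polyfun_meval.
  exact/definable_not/definable_exists_block.
exists (fun e => exists e', agree 2%N e' e /\ P e'); split.
  exact: definable_exists_block.
move=> t s; split.
  move=> [e [eE [[xr1 xr2] [gs noy]]]].
  have e0 : e`_0 = t by rewrite eE.
  have e1 : e`_1 = s by rewrite eE.
  have xE : (\row_i x e i) 0 = x e by apply/funext => i; rewrite mxE.
  exists (\row_i x e i); split.
  - by move=> i; rewrite xE ler_norml xr1 xr2.
  - by move=> i; rewrite xE -e1.
  - move=> z zS; apply: contrapT => tz; apply: noy.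
    have [e' [e'E e'z]] := env_update e (2 + n) (z 0).
    exists e'; split=> //.
    have yE : y e' = z 0 by apply/funext => i; rewrite /y e'z.
    have xE' : x e' = x e.
      by apply/funext => i; rewrite /x e'E // ltn_add2l ltn_ord.
    split; first by move=> i; rewrite yE.
    rewrite yE e'E // e0 xE' => tz'; apply: tz; rewrite (le_trans tz') //.
    by apply: ler_sum => i _; rewrite mxE.
move=> [z [zr gs tz]].
have [e [eE ez]] := env_update [:: t; s] 2 (z 0).
have xE : x e = z 0 by apply/funext => i; rewrite /x ez.
exists e; split=> //; split; [|split].
- by split=> i; have := zr i; rewrite xE ler_norml => /andP[].
- by move=> i; rewrite xE eE.
move=> [e' [e'E [yS]]]; apply.
have -> : x e' = z 0.
  by apply/funext => i; rewrite /x e'E ?ltn_add2l ?ltn_ord// ez.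
rewrite e'E // eE //=.
have := tz (\row_i y e' i).
have -> : (\row_i y e' i) 0 = y e' by apply/funext => i; rewrite mxE.
by apply => i; rewrite (_ : _ 0 = y e') //; apply/funext => j; rewrite mxE.
Qed.

(** The sum of the negative parts of the constraints is continuous and positive on
    the compact set of all points of the cube far from [semialg_set g], hence
    bounded below there. *)
Lemma far_almost_bound (t : R) : 0 < t ->
  exists2 s0, 0 < s0 & forall s x, far_almost t s x -> s0 <= s.
Proof.
move=> t_gt0.
pose far := [set x : 'rV[R]_n | forall y : 'rV[R]_n, semialg_set g y ->
        t <= \sum_i (x 0 i - y 0 i) ^+ 2].
pose K := [set x : 'rV[R]_n | forall i, `|x 0 i| <= r] `&` far.
have [[x0 Kx0]|K0] := pselect (exists x, K x); last first.
  by exists 1 => // s x [xr _ xt]; case: K0; exists x.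
have Kcompact : compact K.
  apply: subclosed_compact (@cube_compact R n r) _; last by move=> x [].
  apply: closedI; first exact: (compact_closed _ (@cube_compact R n r)).
  have -> : far =
      \bigcap_(y in semialg_set g) [set x | t <= \sum_i (x 0 i - y 0 i) ^+ 2].
    by apply/seteqP; split=> x xS y; apply: xS.
  apply: closed_bigI => y _.
  apply: (@closed_comp _ _ (fun x : 'rV[R]_n => \sum_i (x 0 i - y 0 i) ^+ 2)
    [set v | t <= v]); last exact: closed_ge.
  move=> x _.
  suff -> : (fun x : 'rV[R]_n => \sum_i (x 0 i - y 0 i) ^+ 2) =
     (fun x => (\sum_i ('X_i - (y 0 i)%:MP) ^+ 2 : {mpoly R[n]}).@[x 0]).
    exact: meval_continuous.
  apply/funext => z; rewrite raddf_sum /=; apply: eq_bigr => i _.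
  by rewrite rmorphXn /= mevalB mevalXU mevalC.
pose h (x : 'rV[R]_n) : R := \sum_i (`|(tnth g i).@[x 0]| - (tnth g i).@[x 0]).
have h_cont : continuous h.
  rewrite /h => x; elim: (index_enum _) => [|i s IHs].
    rewrite (_ : (fun _ => _) = fun=> 0); first exact: cst_continuous.
    by apply/funext => z; rewrite big_nil.
  rewrite (_ : (fun _ => _) = fun z : 'rV[R]_n =>
    (`|(tnth g i).@[z 0]| - (tnth g i).@[z 0]) +
    \sum_(j <- s) (`|(tnth g j).@[z 0]| - (tnth g j).@[z 0])); last first.
    by apply/funext => z; rewrite big_cons.
  have g_cont := @meval_continuous R n (tnth g i) x.
  apply: continuousD IHs; apply: continuousB; last by apply g_cont.
  apply: (continuous_comp (f := fun z : 'rV[R]_n => (tnth g i).@[z 0])).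
    exact: g_cont.
  exact: norm_continuous.
have [x1 /set_mem Kx1 x1min] : exists2 c, c \in K & forall x, x \in K -> h c <= h x.
  apply: EVT_min_rV => //; first by exists x0.
  exact: continuous_subspaceT.
have h_ge0 i x : 0 <= `|(tnth g i).@[x]| - (tnth g i).@[x].
  by rewrite subr_ge0 ler_norm.
have h_gt0 : 0 < h x1.
  rewrite lt_neqAle sumr_ge0 // andbT eq_sym; apply/negP => /eqP hx1.
  have x1S : semialg_set g x1.
    move=> i; have /(_ i isT)/eqP := psumr_eq0P (fun i _ => h_ge0 i (x1 0)) hx1.
    by rewrite subr_eq0 => /eqP <-.
  have := Kx1.2 _ x1S; rewrite leNgt; case/negP.
  by rewrite big1 // => i _; rewrite subrr expr0n.
exists (h x1 / (2 * m.+1%:R)); first by rewrite divr_gt0 // mulr_gt0.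
move=> s x [xr xs xt]; have Kx : K x by [].
have [s_lt0|s_ge0] := ltP s 0.
  have x_pos i : 0 <= (tnth g i).@[x 0] by rewrite (le_trans _ (xs i)) // oppr_ge0 ltW.
  have := xt _ x_pos; rewrite big1 ?leNgt ?t_gt0 // => i _.
  by rewrite subrr expr0n.
rewrite ler_pdivrMr ?mulr_gt0 //; apply: le_trans (x1min x _) _; first exact: mem_set.
apply: le_trans (_ : \sum_(i < m) 2 * s <= _).
  apply: ler_sum => i _; have := xs i.
  have [gx|gx] := ger0P (tnth g i).@[x 0] => sx; lra.
rewrite sumr_const card_ord -[leLHS]mulr_natr -natr1.
by have : 0 <= s by []; lra.
Qed.

(** Whether [far_almost t s] has a point is semialgebraic in [(t, s)], so the
    answer is constant on a cusp.  For fixed [t] compactness excludes small [s];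
    hence the answer on the cusp is negative. *)
Theorem lojasiewicz : exists L t0, 0 < t0 /\
  forall t (x : 'rV[R]_n), 0 < t < t0 -> (forall i, `|x 0 i| <= r) ->
    (forall y : 'rV[R]_n, semialg_set g y -> t <= \sum_i (x 0 i - y 0 i) ^+ 2) ->
    exists i, (tnth g i).@[x 0] <= - t ^+ L.
Proof.
have [P [defP PE]] := far_almost_definable.
have [[L [r0 [r0_gt0 r0_le1 Pr]]]|[L [r0 [r0_gt0 r0_le1 Pr]]]] := definable_cusp defP.
  (* If the answer were positive, any one [t] would give a contradiction. *)
  have t_gt0 : 0 < r0 / 2 by rewrite divr_gt0.
  have [s0 s0_gt0 s0P] := far_almost_bound t_gt0.
  have [|x xP] := (PE (r0 / 2) (Num.min s0 ((r0 / 2) ^+ L) / 2)).1.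
    apply: Pr; split=> //; first by rewrite ltr_pdivrMr // ltr_pMr // ltr1n.
      by rewrite divr_gt0 // lt_min s0_gt0 exprn_gt0.
    rewrite ltr_pdivrMr // gt_min; apply/orP; right.
    by rewrite ltr_pMr ?exprn_gt0 // ltr1n.
  have := s0P _ _ xP; rewrite leNgt; case/negP.
  by rewrite ltr_pdivrMr // gt_min ltr_pMr // ltr1n.
exists L.+1, r0; split=> // t x /andP[t_gt0 tr] xr xt.
apply: contrapT => /forallNP no; apply: (Pr t (t ^+ L.+1)).
  split=> //; first by rewrite exprn_gt0.
  by rewrite exprSr gtr_pMr ?exprn_gt0 // (lt_le_trans tr).
apply/PE; exists x; split=> // i.
by have /negP := no i; rewrite -ltNge => /ltW.
Qed.

End Lojasiewicz.

(** * Bernstein coefficients *)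

Section UnivariateBernstein.
Variable R : realFieldType.

Definition bernstein (T : comNzRingType) (N i : nat) (x : T) : T :=
  (x ^+ i * (1 - x) ^+ (N - i)) *+ 'C(N, i).

(** The [i]-th Bernstein coefficient, in degree [N], of the monomial [x ^+ a]: a
    quotient of falling factorials in place of the power [(i / N) ^+ a]. *)
Definition bern_weight (N a i : nat) : R := 'C(i, a)%:R / 'C(N, a)%:R.

Lemma mul_bin_trinomial (N a j : nat) : (a + j <= N)%N ->
  ('C(a + j, a) * 'C(N, a + j) = 'C(N, a) * 'C(N - a, j))%N.
Proof.
move=> ajN.
have aN : (a <= N)%N := leq_trans (leq_addr j a) ajN.
have jN : (j <= N - a)%N by rewrite -(leq_add2l a) subnKC.
have posf : (0 < a`! * j`! * (N - a - j)`!)%N by rewrite !muln_gt0 !fact_gt0.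
apply/eqP; rewrite -(eqn_pmul2r posf); apply/eqP.
have E1 := bin_fact (leq_addr j a); rewrite addKn in E1.
have E2 := bin_fact ajN; rewrite subnDA in E2.
have E3 := bin_fact aN; have E4 := bin_fact jN.
have -> : ('C(a + j, a) * 'C(N, a + j) * (a`! * j`! * (N - a - j)`!) =
           'C(N, a + j) * ('C(a + j, a) * (a`! * j`!) * (N - a - j)`!))%N by ring.
rewrite E1 E2.
have -> : ('C(N, a) * 'C(N - a, j) * (a`! * j`! * (N - a - j)`!) =
           'C(N, a) * (a`! * ('C(N - a, j) * (j`! * (N - a - j)`!))))%N by ring.
by rewrite E4 E3.
Qed.

(** Expanding [x ^+ a = x ^+ a * (x + (1 - x)) ^+ (N - a)]. *)
Lemma expr_bernstein (T : comNzRingType) (x : T) (N a : nat) :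
  (a <= N)%N -> x ^+ a *+ 'C(N, a) =
  \sum_(i < N.+1) bernstein N i x *+ 'C(i, a).
Proof.
move=> aN.
have -> : x ^+ a = x ^+ a * (1 - x + x) ^+ (N - a) by rewrite subrK expr1n mulr1.
rewrite exprDn big_distrr /= -sumrMnl.
rewrite -(big_mkord xpredT (fun i => bernstein N i x *+ 'C(i, a))).
rewrite (big_cat_nat (n := a)) //=; last exact: leqW.
have -> : \sum_(0 <= i < a) bernstein N i x *+ 'C(i, a) = 0.
  by rewrite big_nat big1 // => i ia; rewrite bin_small.
rewrite add0r -[X in index_iota X _]add0n big_addn subSn // big_mkord.
apply: eq_bigr => -[j /= jN] _; rewrite ltnS in jN.
have ajN : (a + j <= N)%N by rewrite -leq_subRL.
rewrite /bernstein addnC mulrnAr -!mulrnA; congr (_ *+ _).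
  by rewrite subnDA exprD; ring.
by rewrite [LHS]mulnC [RHS]mulnC mul_bin_trinomial.
Qed.

(** The weight is the product of the factors [(i - l) / (N - l)] for [l < a], each
    of which is within [l / N] of [i / N]. *)
Lemma bern_weight_approx (N a i : nat) : (0 < N)%N -> (a <= N)%N -> (i <= N)%N ->
  0 <= bern_weight N a i <= 1 /\
  `|bern_weight N a i - (i%:R / N%:R) ^+ a| <= (a * a)%:R / N%:R.
Proof.
move=> N_gt0 aN iN.
have N0 : 0 < N%:R :> R by rewrite ltr0n.
have iN01 : 0 <= (i%:R / N%:R : R) <= 1.
  by rewrite divr_ge0 //= ler_pdivrMr // mul1r ler_nat.
elim: a aN => [_|a IHa aN].
  rewrite /bern_weight !bin0 divr1 expr0 subrr normr0 mul0n mul0r.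
  by rewrite ler01 lexx.
have [w01 wP] := IHa (ltnW aN).
have Na : 0 < (N - a)%:R :> R by rewrite ltr0n subn_gt0.
pose th : R := (i - a)%:R / (N - a)%:R.
have wE : bern_weight N a.+1 i = bern_weight N a i * th.
  rewrite /bern_weight /th mulf_div -!natrM -![('C(_, a) * _)%N]mulnC.
  rewrite -!mul_bin_left !natrM -mulf_div divff ?mul1r //.
have th01 : 0 <= th <= 1.
  by rewrite divr_ge0 //= ler_pdivrMr // mul1r ler_nat leq_sub2r.
have thE : `|th - i%:R / N%:R| <= a%:R / N%:R.
  rewrite /th; have [ia|ai] := ltnP i a.
    rewrite (eqP (ltnW ia)) mul0r sub0r normrN ger0_norm ?divr_ge0 //.
    by rewrite ler_pM2r ?invr_gt0 // ler_nat ltnW.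
  have aN' := ltnW aN; rewrite !natrB //.
  have -> : (i%:R - a%:R) / (N%:R - a%:R) - i%:R / N%:R =
      - (a%:R / N%:R * ((N%:R - i%:R) / (N%:R - a%:R))) :> R.
    by field; rewrite -natrB // !gt_eqF.
  rewrite normrN ger0_norm; last by rewrite -!natrB // !mulr_ge0 // invr_ge0.
  rewrite ler_piMr ?divr_ge0 // -!natrB //.
  by rewrite ler_pdivrMr // mul1r ler_nat leq_sub2l.
rewrite wE; split.
  by case/andP: w01 => ? ?; case/andP: th01 => ? ?; rewrite mulr_ge0 //= mulr_ile1.
have -> : bern_weight N a i * th - (i%:R / N%:R) ^+ a.+1 =
    bern_weight N a i * (th - i%:R / N%:R) +
    (bern_weight N a i - (i%:R / N%:R) ^+ a) * (i%:R / N%:R) by rewrite exprSr; ring.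
have le1 : `|bern_weight N a i * (th - i%:R / N%:R)| <= a%:R / N%:R.
  case/andP: w01 => w0 w1; rewrite normrM (ger0_norm w0) -[leRHS]mul1r.
  by rewrite ler_pM.
have le2 : `|(bern_weight N a i - (i%:R / N%:R) ^+ a) * (i%:R / N%:R)| <=
    (a * a)%:R / N%:R.
  case/andP: iN01 => i0 i1; rewrite normrM (ger0_norm i0) -[leRHS]mulr1.
  by rewrite ler_pM.
apply: le_trans (ler_normD _ _) _; apply: le_trans (lerD le1 le2) _.
rewrite -mulrDl ler_pM2r ?invr_gt0 // -natrD ler_nat.
by rewrite mulSn mulnS leq_addl.
Qed.

End UnivariateBernstein.

Section MultivariateBernstein.
Variables (R : realFieldType) (n : nat).
Implicit Types (p q : {mpoly R[n]}) (A B : R) (D E : nat).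

(** A list of terms is used instead of the list of coefficients of [p], so that
    sums and products of such bounds need no collection of like terms. *)
Definition coef_bound A D p : Prop := exists2 s : seq (R * 'X_{1..n}),
  p = \sum_(c <- s) c.1 *: 'X_[c.2] &
  \sum_(c <- s) `|c.1| <= A /\ forall c, c \in s -> (mdeg c.2 <= D)%N.

Lemma coef_bound_ge0 A D p : coef_bound A D p -> 0 <= A.
Proof. by move=> [s _ [sA _]]; apply: le_trans sA; apply: sumr_ge0. Qed.

Lemma coef_bound_exists p : exists A D, coef_bound A D p.
Proof.
exists (\sum_(m <- msupp p) `|p@_m|), (msize p).
exists [seq (p@_m, m) | m <- msupp p].
  by rewrite big_map /= -mpolyE.
split; first by rewrite big_map.
by move=> c /mapP[m /msize_mdeg_lt /ltnW mp ->].
Qed.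

Lemma coef_boundW A D A' D' p :
  A <= A' -> (D <= D')%N -> coef_bound A D p -> coef_bound A' D' p.
Proof.
move=> AA' DD' [s pE [sA sD]]; exists s => //; split; first exact: le_trans AA'.
by move=> c /sD cD; apply: leq_trans DD'.
Qed.

Lemma coef_boundC (a : R) : coef_bound `|a| 0 a%:MP.
Proof.
exists [:: (a, 0%MM)]; first by rewrite big_seq1 /= mpolyX0 alg_mpolyC.
split; first by rewrite big_seq1.
by move=> c; rewrite inE => /eqP -> /=; rewrite mdeg0.
Qed.

Lemma coef_boundD A B D E p q : coef_bound A D p -> coef_bound B E q ->
  coef_bound (A + B) (maxn D E) (p + q).
Proof.
move=> [s -> [sA sD]] [t -> [tB tE]]; exists (s ++ t); first by rewrite big_cat.
split; first by rewrite big_cat /= lerD.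
move=> c; rewrite mem_cat leq_max => /orP[/sD ->//|/tE ->]; exact: orbT.
Qed.

Lemma coef_boundM A B D E p q : coef_bound A D p -> coef_bound B E q ->
  coef_bound (A * B) (D + E) (p * q).
Proof.
move=> [s -> [sA sD]] [t -> [tB tE]].
exists [seq (c.1 * d.1, (c.2 + d.2)%MM) | c <- s, d <- t].
  rewrite big_allpairs_dep /= big_distrl /=; apply: eq_bigr => c _.
  rewrite big_distrr /=; apply: eq_bigr => d _.
  by rewrite mpolyXD -scalerAl -scalerAr scalerA.
split; last first.
  by move=> _ /allpairsP[[c d] /= [cs dt ->]] /=; rewrite mdegD leq_add ?sD ?tE.
rewrite big_allpairs_dep /=.
under eq_bigr => c _.
  under eq_bigr => d _ do rewrite normrM.
  rewrite -mulr_sumr; over.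
by rewrite -mulr_suml ler_pM // sumr_ge0.
Qed.

Lemma coef_boundZ (a : R) A D p : coef_bound A D p -> coef_bound (`|a| * A) D (a *: p).
Proof. by rewrite -mul_mpolyC; apply: coef_boundM (coef_boundC a). Qed.

Lemma coef_boundX A D p k : coef_bound A D p -> coef_bound (A ^+ k) (k * D) (p ^+ k).
Proof.
move=> pA; elim: k => [|k IHk].
  by have := coef_boundC 1; rewrite normr1 expr0 mpolyC1.
by rewrite !exprS mulSn; apply: coef_boundM.
Qed.

Lemma prod_dist01 (I : Type) (r : seq I) (F G : I -> R) :
  (forall i, 0 <= F i <= 1) -> (forall i, 0 <= G i <= 1) ->
  0 <= \prod_(i <- r) G i <= 1 /\
  `|\prod_(i <- r) F i - \prod_(i <- r) G i| <= \sum_(i <- r) `|F i - G i|.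
Proof.
move=> F01 G01; elim: r => [|i r [/andP[P0 P1] IHr]].
  by rewrite !big_nil subrr normr0 lexx ler01.
rewrite !big_cons; have /andP[F0 F1] := F01 i; have /andP[G0 G1] := G01 i.
split; first by rewrite mulr_ge0 //= mulr_ile1.
set P := \prod_(j <- r) F j in IHr *; set Q := \prod_(j <- r) G j in P0 P1 IHr *.
have -> : F i * P - G i * Q = (F i - G i) * Q + F i * (P - Q) by ring.
apply: le_trans (ler_normD _ _) _; rewrite !normrM (ger0_norm F0) (ger0_norm P0).
apply: lerD; first by rewrite ler_piMr.
by apply: le_trans IHr; rewrite ler_piMl.
Qed.

Lemma mnm_le_mdeg (m : 'X_{1..n}) j : (m j <= mdeg m)%N.
Proof. by rewrite mdegE (bigD1 j) //= leq_addr. Qed.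

Lemma mpolyX_bernstein (N a : nat) (j : 'I_n) : (a <= N)%N -> 'X_j ^+ a =
  \sum_(i < N.+1) bern_weight R N a i *: bernstein N i ('X_j : {mpoly R[n]}).
Proof.
move=> aN; have C0 : 'C(N, a)%:R != 0 :> R by rewrite pnatr_eq0 -lt0n bin_gt0.
apply: (scalerI C0); rewrite scaler_nat expr_bernstein // scaler_sumr.
apply: eq_bigr => i _; rewrite scalerA /bern_weight mulrC divfK //.
by rewrite scaler_nat.
Qed.

(** The Bernstein coefficients of [p] approximate the values of [p] on the grid,
    with an error that tends to [0] like [1 / N]; once it is smaller than a
    positive lower bound of [p] on the unit cube, they are all nonnegative. *)
Lemma bernstein_certificate A D p (eta : R) N :
  coef_bound A D p -> (0 < N)%N -> (D <= N)%N ->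
  (forall v : 'I_n -> R, (forall i, 0 <= v i <= 1) -> eta <= p.@[v]) ->
  A * (D * D)%:R / N%:R <= eta ->
  exists c : {ffun 'I_n -> 'I_N.+1} -> R,
    (forall f, 0 <= c f) /\
    p = \sum_f c f *: \prod_j bernstein N (f j) ('X_j : {mpoly R[n]}).
Proof.
move=> [s pE [sA sD]] N_gt0 DN p_ge etaP.
pose W (m : 'X_{1..n}) (f : {ffun 'I_n -> 'I_N.+1}) : R :=
  \prod_j bern_weight R N (m j) (f j).
have degN d j : d \in s -> (d.2 j <= D)%N.
  by move=> /sD; apply: leq_trans; apply: mnm_le_mdeg.
exists (fun f => \sum_(d <- s) d.1 * W d.2 f); split=> [f|]; last first.
  have XE d : d \in s -> 'X_[d.2] =
      \sum_f W d.2 f *: \prod_j bernstein N (f j) ('X_j : {mpoly R[n]}).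
    move=> ds; rewrite mpolyXE_id.
    rewrite (eq_bigr (fun j => \sum_(i < N.+1)
        bern_weight R N (d.2 j) i *: bernstein N i ('X_j : {mpoly R[n]}))).
      by rewrite bigA_distr_bigA; apply: eq_bigr => f _; rewrite scaler_prod.
    by move=> j _; rewrite -mpolyX_bernstein // (leq_trans _ DN) // degN.
  rewrite pE big_seq; under eq_bigr => d ds do rewrite XE // scaler_sumr.
  rewrite -big_seq exchange_big /=; apply: eq_bigr => f _.
  by rewrite scaler_suml; apply: eq_bigr => d _; rewrite scalerA.
pose v j : R := (f j)%:R / N%:R.
have N0 : 0 < N%:R :> R by rewrite ltr0n.
have v01 j : 0 <= v j <= 1.
  by rewrite /v divr_ge0 //= ler_pdivrMr // mul1r ler_nat -ltnS.
have := p_ge v v01; rewrite {1}pE raddf_sum /=.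
under eq_bigr => d _ do rewrite mevalZ mevalX.
move=> eta_le.
have dist d : d \in s -> `|W d.2 f - \prod_j v j ^+ d.2 j| <= (D * D)%:R / N%:R.
  move=> ds.
  have wP j := @bern_weight_approx R N (d.2 j) (f j) N_gt0
    (leq_trans (degN _ j ds) DN) (ltn_ord (f j)).
  have vX j : 0 <= v j ^+ d.2 j <= 1.
    by have /andP[v0 v1] := v01 j; rewrite exprn_ge0 //= exprn_ile1.
  have [_ dP] := prod_dist01 (index_enum _) (fun j => (wP j).1) vX.
  apply: le_trans dP _; apply: le_trans (ler_sum _ (fun j _ => (wP j).2)) _.
  rewrite -mulr_suml ler_pM2r ?invr_gt0 // -natr_sum ler_nat.
  apply: leq_trans (_ : \sum_j d.2 j * D <= _)%N.
    by apply: leq_sum => j _; rewrite leq_mul2l degN ?orbT.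
  by rewrite -big_distrl /= -mdegE leq_mul2r sD ?orbT.
rewrite -subr_ge0 subr0.
have : \sum_(d <- s) d.1 * \prod_j v j ^+ d.2 j - \sum_(d <- s) d.1 * W d.2 f <=
    A * ((D * D)%:R / N%:R).
  rewrite -sumrB; apply: le_trans (_ : \sum_(d <- s) `|d.1| * ((D * D)%:R / N%:R) <= _).
    rewrite big_seq [leRHS]big_seq; apply: ler_sum => d ds.
    rewrite -mulrBr (le_trans (ler_norm _)) // normrM ler_wpM2l // distrC.
    exact: dist.
  by rewrite -mulr_suml ler_wpM2r // divr_ge0.
rewrite mulrA => AP; move: AP etaP eta_le; lra.
Qed.

End MultivariateBernstein.

(** * Degree bounds in the quadratic module *)

Section DegreeBounds.
Variables (R : realType) (n : nat).
Implicit Types (p q s : {mpoly R[n]}).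

Lemma tdegM p q : (tdeg (p * q) <= tdeg p + tdeg q)%N.
Proof.
rewrite /tdeg; have [->|p0] := eqVneq p 0; first by rewrite mul0r msize0.
have [->|q0] := eqVneq q 0; first by rewrite mulr0 msize0.
rewrite msizeM //; move: p0 q0; rewrite -!msize_poly_eq0.
by case: (msize p) => // a; case: (msize q) => // b; rewrite addnS addSn.
Qed.

Lemma tdegD p q : (tdeg (p + q) <= maxn (tdeg p) (tdeg q))%N.
Proof.
rewrite /tdeg; have := msizeD_le p q.
by case: (msize (p + q)) (msize p) (msize q) => // a [|b] [|c] //=; rewrite ?maxnSS ?max0n ?maxn0.
Qed.

Lemma tdegD_le D p q : (tdeg p <= D)%N -> (tdeg q <= D)%N -> (tdeg (p + q) <= D)%N.
Proof. by move=> pD qD; rewrite (leq_trans (tdegD _ _)) // geq_max pD. Qed.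

Lemma tdegM_le D E p q :
  (tdeg p <= D)%N -> (tdeg q <= E)%N -> (tdeg (p * q) <= D + E)%N.
Proof. by move=> pD qE; rewrite (leq_trans (tdegM _ _)) // leq_add. Qed.

Lemma tdegC (c : R) : tdeg (c%:MP : {mpoly R[n]}) = 0%N.
Proof. by rewrite /tdeg msizeC; case: eqP. Qed.

Lemma tdegXU (i : 'I_n) : tdeg ('X_i : {mpoly R[n]}) = 1%N.
Proof. by rewrite /tdeg msizeX mdeg1. Qed.

Lemma tdegX_le D p k : (tdeg p <= D)%N -> (tdeg (p ^+ k) <= k * D)%N.
Proof.
move=> pD; elim: k => [|k IHk]; first by rewrite expr0 -mpolyC1 tdegC.
by rewrite exprS mulSn tdegM_le.
Qed.

Lemma tdeg_sum_le D (I : Type) (r : seq I) (P : pred I) (F : I -> {mpoly R[n]}) :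
  (forall i, P i -> tdeg (F i) <= D)%N -> (tdeg (\sum_(i <- r | P i) F i) <= D)%N.
Proof.
move=> FD; elim/big_ind: _ => //; first by rewrite /tdeg msize0.
by move=> p q; apply: tdegD_le.
Qed.

Lemma sos0 : sos (0 : {mpoly R[n]}).
Proof. by exists [::]; rewrite big_nil. Qed.

Lemma sos_sqr p : sos (p ^+ 2).
Proof. by exists [:: p]; rewrite big_seq1. Qed.

Lemma sosC (c : R) : 0 <= c -> sos (c%:MP : {mpoly R[n]}).
Proof.
move=> c0; exists [:: (Num.sqrt c)%:MP].
by rewrite big_seq1 -rmorphXn /= sqr_sqrtr.
Qed.

Lemma sosD p q : sos p -> sos q -> sos (p + q).
Proof. by move=> [s ->] [t ->]; exists (s ++ t); rewrite big_cat. Qed.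

Lemma sosM p q : sos p -> sos q -> sos (p * q).
Proof.
move=> [s ->] [t ->]; exists [seq a * b | a <- s, b <- t].
rewrite big_allpairs_dep /= big_distrl /=; apply: eq_bigr => a _.
by rewrite big_distrr /=; apply: eq_bigr => b _; rewrite exprMn.
Qed.

Lemma sos_sum (I : Type) (r : seq I) (P : pred I) (F : I -> {mpoly R[n]}) :
  (forall i, P i -> sos (F i)) -> sos (\sum_(i <- r | P i) F i).
Proof. by move=> FS; elim/big_ind: _ => //; [exact: sos0 | exact: sosD]. Qed.

Lemma sos_ge0 p (v : 'I_n -> R) : sos p -> 0 <= p.@[v].
Proof.
move=> [s ->]; rewrite raddf_sum; apply: sumr_ge0 => q _ /=.
by rewrite rmorphXn /= sqr_ge0.
Qed.

Section PrincipalModule.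
Variables (b : {mpoly R[n]}) (b_deg : (tdeg b <= 2)%N).

(** The quadratic module of the single polynomial [b]. Because [b ^+ 2] is a
    square, it is closed under products, which a quadratic module with more
    generators need not be. The bound [D] is on the multipliers. *)
Definition principal_module (D : nat) p : Prop := exists s0 s1,
  [/\ sos s0, sos s1, (tdeg s0 <= D)%N, (tdeg s1 <= D)%N & p = s0 + s1 * b].

Lemma principal_moduleW D E p : (D <= E)%N ->
  principal_module D p -> principal_module E p.
Proof.
move=> DE [s0 [s1 [S0 S1 d0 d1 ->]]]; exists s0, s1.
by split=> //; apply: leq_trans DE.
Qed.

Lemma principal_moduleC (c : R) : 0 <= c -> principal_module 0 c%:MP.
Proof.
move=> c0; exists c%:MP, 0; rewrite mul0r addr0.
by split=> //; [exact: sosC | exact: sos0 | rewrite tdegC | rewrite /tdeg msize0].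
Qed.

Lemma principal_moduleD D p q :
  principal_module D p -> principal_module D q -> principal_module D (p + q).
Proof.
move=> [s0 [s1 [S0 S1 d0 d1 ->]]] [t0 [t1 [T0 T1 e0 e1 ->]]].
exists (s0 + t0), (s1 + t1); split; try exact: sosD; try exact: tdegD_le.
by ring.
Qed.

(** The [4] is the degree of [b ^+ 2], which the product of the two terms in [b]
    contributes to the new sum of squares. *)
Lemma principal_moduleM D E p q : principal_module D p ->
  principal_module E q -> principal_module (D + E + 4) (p * q).
Proof.
move=> [s0 [s1 [S0 S1 d0 d1 ->]]] [t0 [t1 [T0 T1 e0 e1 ->]]].
exists (s0 * t0 + s1 * t1 * b ^+ 2), (s0 * t1 + s1 * t0); split.
- by apply: sosD; [|apply: sosM; last exact: sos_sqr]; apply: sosM.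
- by apply: sosD; apply: sosM.
- apply: tdegD_le; first by rewrite (leq_trans _ (leq_addr _ _)) // tdegM_le.
  by apply: tdegM_le; [exact: tdegM_le | exact: (tdegX_le 2 b_deg)].
- by rewrite (leq_trans _ (leq_addr _ _)) // tdegD_le // tdegM_le.
- by ring.
Qed.

Lemma principal_moduleZ D (c : R) p : 0 <= c ->
  principal_module D p -> principal_module D (c *: p).
Proof.
move=> c0 [s0 [s1 [S0 S1 d0 d1 ->]]]; exists (c%:MP * s0), (c%:MP * s1).
split; try by apply: sosM => //; exact: sosC.
- by rewrite -[D]add0n tdegM_le // tdegC.
- by rewrite -[D]add0n tdegM_le // tdegC.
- by rewrite -mul_mpolyC mulrDr mulrA.
Qed.

Lemma principal_module_sum D (I : Type) (r : seq I) (F : I -> {mpoly R[n]}) :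
  (forall i, principal_module D (F i)) -> principal_module D (\sum_(i <- r) F i).
Proof.
move=> FD; elim/big_ind: _ => //; last exact: principal_moduleD.
by rewrite -mpolyC0; apply: principal_moduleW (principal_moduleC _).
Qed.

Lemma principal_moduleX D p k : principal_module D p ->
  principal_module (k * (D + 4)) (p ^+ k).
Proof.
move=> pD; elim: k => [|k IHk].
  by rewrite expr0 -mpolyC1; apply: principal_moduleC ler01.
rewrite exprS mulSn addnAC; exact: principal_moduleM.
Qed.

Lemma principal_module_prod D (I : Type) (r : seq I) (F : I -> {mpoly R[n]}) :
  (forall i, principal_module D (F i)) ->
  principal_module (size r * (D + 4)) (\prod_(i <- r) F i).
Proof.
move=> FD; elim: r => [|i r IHr].
  by rewrite big_nil -mpolyC1; apply: principal_moduleC ler01.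
by rewrite big_cons /= mulSn addnAC; apply: principal_moduleM.
Qed.

Lemma principal_module_bernstein D p (N i : nat) : (i <= N)%N ->
  principal_module D p -> principal_module D (1 - p) ->
  principal_module (N * (D + 4) + 4) (bernstein N i p).
Proof.
move=> iN pD qD; rewrite /bernstein -scaler_nat; apply: principal_moduleZ => //.
have -> : (N * (D + 4) = i * (D + 4) + (N - i) * (D + 4))%N.
  by rewrite -mulnDl subnKC.
by apply: principal_moduleM; apply: principal_moduleX.
Qed.

End PrincipalModule.

(** The substitution that maps the unit cube onto the cube of side [2 * r], and
    its inverse. *)
Definition cube_scale (r : R) : n.-tuple {mpoly R[n]} :=
  [tuple (2 * r) *: 'X_i - r%:MP | i < n].
Definition cube_unscale (r : R) : n.-tuple {mpoly R[n]} :=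
  [tuple (2 * r)^-1 *: ('X_i + r%:MP) | i < n].

Lemma cube_scaleK (r : R) p : 0 < r ->
  (p \mPo cube_scale r) \mPo cube_unscale r = p.
Proof.
move=> r0; elim/mpoly_ring_ind: p => [c|i|p q IHp IHq|p q IHp IHq].
- by rewrite !comp_mpolyC.
- rewrite comp_mpolyXU -tnth_nth tnth_mktuple comp_mpolyB comp_mpolyZ.
  rewrite comp_mpolyXU comp_mpolyC -tnth_nth tnth_mktuple scalerA.
  by rewrite divff ?scale1r ?addrK // mulf_neq0 ?gt_eqF.
- by rewrite !comp_mpolyD IHp IHq.
- by rewrite !rmorphM /= IHp IHq.
Qed.

Definition ball_poly (N : nat) : {mpoly R[n]} := N%:R - \sum_(i < n) 'X_i ^+ 2.

Lemma ball_deg (N : nat) : (tdeg (ball_poly N) <= 2)%N.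
Proof.
apply: tdegD_le; first by rewrite -mpolyC_nat tdegC.
rewrite /tdeg msizeN; apply: tdeg_sum_le => i _.
by rewrite (leq_trans (tdegX_le 2 (leqnn _))) // tdegXU.
Qed.

(** [4 r^2 y = (X_j + r)^2 + (r^2 - N) + sum_(i != j) X_i^2 + ball_poly N] for
    [y = (X_j + r) / 2 r], and similarly for [1 - y] with [r - X_j]. *)
Lemma cube_unscale_module (N : nat) (r : R) (j : 'I_n) : 0 < r -> N%:R <= r ^+ 2 ->
  principal_module (ball_poly N) 2 (tnth (cube_unscale r) j) /\
  principal_module (ball_poly N) 2 (1 - tnth (cube_unscale r) j).
Proof.
move=> r0 Nr; rewrite tnth_mktuple.
have r0' : r != 0 by rewrite gt_eqF.
pose c : R := (4 * r ^+ 2)^-1.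
have c0 : 0 <= c by rewrite invr_ge0 mulr_ge0 // exprn_ge0 // ltW.
have aff (a : R) : principal_module (ball_poly N) 2
   (c *: ((a *: 'X_j + r%:MP) ^+ 2 + (r ^+ 2 - N%:R)%:MP +
          \sum_(i < n | i != j) 'X_i ^+ 2 + ball_poly N)).
  apply: principal_moduleZ => //.
  exists ((a *: 'X_j + r%:MP) ^+ 2 + (r ^+ 2 - N%:R)%:MP +
          \sum_(i < n | i != j) 'X_i ^+ 2), 1; split.
  - apply: sosD; last by apply: sos_sum => i _; apply: sos_sqr.
    by apply: sosD; [exact: sos_sqr | apply: sosC; rewrite subr_ge0].
  - by rewrite -mpolyC1; apply: sosC.
  - apply: tdegD_le; last first.
      by apply: tdeg_sum_le => i _; rewrite (leq_trans (tdegX_le 2 (leqnn _))) // tdegXU.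
    apply: tdegD_le; last by rewrite tdegC.
    apply: (@tdegX_le 1); apply: tdegD_le; last by rewrite tdegC.
    by rewrite -mul_mpolyC -[1%N]add0n tdegM_le ?tdegC // tdegXU.
  - by rewrite -mpolyC1 tdegC.
  - by rewrite mul1r.
have E (a : R) : a ^+ 2 = 1 -> (2 * r)^-1 *: (a *: 'X_j + r%:MP) =
   c *: ((a *: 'X_j + r%:MP) ^+ 2 + (r ^+ 2 - N%:R)%:MP +
          \sum_(i < n | i != j) 'X_i ^+ 2 + ball_poly N).
  move=> a2; rewrite (_ : _ + ball_poly N = (2 * r) *: (a *: 'X_j + r%:MP)).
    by rewrite scalerA; congr (_ *: _); rewrite /c; field.
  have aM : a%:MP ^+ 2 = 1 :> {mpoly R[n]} by rewrite -rmorphXn a2.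
  have rM : (r ^+ 2)%:MP = r%:MP ^+ 2 :> {mpoly R[n]} by rewrite rmorphXn.
  have r2M : (2 * r)%:MP = 2 * r%:MP :> {mpoly R[n]} by rewrite mpolyCM mpolyC_nat.
  rewrite /ball_poly [X in N%:R - X](bigD1 j) //= -!mul_mpolyC mpolyCB mpolyC_nat rM r2M.
  set S := \sum_(i < n | _) _; set x := 'X_j.
  by ring: aM.
split.
  have -> : 'X_j + r%:MP = 1 *: 'X_j + r%:MP :> {mpoly R[n]} by rewrite scale1r.
  by rewrite E ?expr1n.
have -> : 1 - (2 * r)^-1 *: ('X_j + r%:MP) =
     (2 * r)^-1 *: (-1 *: 'X_j + r%:MP) :> {mpoly R[n]}.
  have -> : 1 = (2 * r)^-1 *: (r%:MP + r%:MP) :> {mpoly R[n]}.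
    rewrite -mpolyCD -mul_mpolyC -mpolyCM (_ : _ * _ = 1) ?mpolyC1 //.
    by field.
  by rewrite -scalerBr scaleN1r; congr (_ *: _); ring.
by rewrite E ?sqrrN ?expr1n.
Qed.

(** After the substitution the Bernstein basis consists of products of powers of
    the polynomials of [cube_unscale_module]. *)
Lemma ball_certificate (N : nat) (r : R) A D p (eta : R) (k : nat) :
  0 < r -> N%:R <= r ^+ 2 -> coef_bound A D (p \mPo cube_scale r) ->
  (0 < k)%N -> (D <= k)%N ->
  (forall v : 'I_n -> R, (forall i, `|v i| <= r) -> eta <= p.@[v]) ->
  A * (D * D)%:R / k%:R <= eta ->
  principal_module (ball_poly N) (n * (k * 6 + 8)) p.
Proof.
move=> r0 Nr pA k0 Dk p_ge etaP.
have [v v01|c [c_ge0 pE]] := bernstein_certificate pA k0 Dk _ etaP.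
  rewrite comp_mpoly_meval; apply: p_ge => i.
  rewrite tnth_mktuple mevalB mevalZ mevalXU mevalC ler_norml.
  by have /andP[v0 v1] := v01 i; apply/andP; split; nra.
rewrite -(cube_scaleK p r0) pE raddf_sum /=; apply: principal_module_sum => f.
rewrite comp_mpolyZ; apply: principal_moduleZ => //; rewrite rmorph_prod /=.
rewrite (_ : n * _ = size (index_enum 'I_n) * (k * 6 + 4 + 4))%N; last first.
  by rewrite -addnA -sum1_size big_const_ord iter_addn_0 mul1n.
apply: principal_module_prod; first exact: ball_deg.
move=> j; have [yj y1j] := cube_unscale_module j r0 Nr.
rewrite /bernstein rmorphMn rmorphM !rmorphXn rmorphB rmorph1 /=.
rewrite comp_mpolyXU -tnth_nth.
apply: (principal_module_bernstein _ _ yj y1j); first exact: ball_deg.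
by rewrite -ltnS.
Qed.

End DegreeBounds.

(** * Perturbation by the constraints *)

Section Perturbation.
Variables (R : realType) (n m : nat) (g : m.-tuple {mpoly R[n]}).
Implicit Types (p q f : {mpoly R[n]}).

Lemma quad_module_leW (a b : R) p : a <= b ->
  quad_module_le g a p -> quad_module_le g b p.
Proof.
move=> ab [s [S d ->]]; exists s; split=> // i; exact: le_trans ab.
Qed.

Lemma quad_module_leD (a : R) p q :
  quad_module_le g a p -> quad_module_le g a q -> quad_module_le g a (p + q).
Proof.
move=> [s [S d ->]] [t [T e ->]]; exists (fun i => s i + t i); split.
- by move=> i; apply: sosD.
- move=> i; rewrite mulrDl.
  apply: (@le_trans _ _ (maxn (tdeg (s i * tnth (gext g) i))
    (tdeg (t i * tnth (gext g) i)))%:R); first by rewrite ler_nat tdegD.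
  by rewrite /maxn; case: ifP.
- by rewrite -big_split /=; apply: eq_bigr => i _; rewrite mulrDl.
Qed.

Lemma quad_module_le_sum (I : Type) (r : seq I) (F : I -> {mpoly R[n]}) (a : R) :
  0 <= a -> (forall i, quad_module_le g a (F i)) ->
  quad_module_le g a (\sum_(i <- r) F i).
Proof.
move=> a0 FM; elim/big_ind: _ => //; last exact: quad_module_leD.
exists (fun=> 0); split; first by move=> i; apply: sos0.
  by move=> i; rewrite mul0r /tdeg msize0.
by rewrite big1 // => i _; rewrite mul0r.
Qed.

Lemma quad_module_le_gen (i : 'I_m) D p : sos p -> (tdeg (p * tnth g i) <= D)%N ->
  quad_module_le g D%:R (p * tnth g i).
Proof.
move=> pS pD; exists (fun j => if j == lift ord0 i then p else 0); split.
- by move=> j; case: ifP => _ //; apply: sos0.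
- move=> j; case: eqP => [->|_]; last by rewrite mul0r /tdeg msize0.
  by rewrite tnthS ler_nat.
- rewrite (bigD1 (lift ord0 i)) //= eqxx tnthS big1 ?addr0 // => j /negPf ->.
  by rewrite mul0r.
Qed.

(** Replacing [b] by a representation of it raises the degree by a constant only. *)
Lemma principal_module_quad b : quad_module g b -> exists d0, forall D p,
  principal_module b D p -> quad_module_le g (D + d0)%:R p.
Proof.
move=> [t [T bE]]; pose d0 := (\sum_i tdeg (t i * tnth (gext g) i))%N.
have td0 i : (tdeg (t i * tnth (gext g) i) <= d0)%N.
  by rewrite /d0 (bigD1 i) //= leq_addr.
exists d0 => D p [s0 [s1 [S0 S1 e0 e1 ->]]].
exists (fun i => (if i == ord0 then s0 else 0) + s1 * t i); split.
- move=> i; apply: sosD; last exact: sosM.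
  by case: ifP => _ //; apply: sos0.
- move=> i; rewrite ler_nat mulrDl -mulrA; apply: tdegD_le; last exact: tdegM_le.
  case: eqP => [->|_]; last by rewrite mul0r /tdeg msize0.
  by rewrite tnth0 mulr1 (leq_trans e0) // leq_addr.
- under eq_bigr => i _ do rewrite mulrDl -mulrA.
  rewrite big_split /= -mulr_sumr -bE (bigD1 ord0) //= tnth0 mulr1.
  by rewrite big1 ?addr0 // => i /negPf ->; rewrite mul0r.
Qed.

Lemma quad_module_le_ge0 (a : R) p (x : 'rV[R]_n) :
  quad_module_le g a p -> semialg_set g x -> 0 <= p.@[x 0].
Proof.
move=> [s [S _ ->]] xS; rewrite raddf_sum; apply: sumr_ge0 => i _ /=.
rewrite mevalM mulr_ge0 //; first exact: sos_ge0.
case: (unliftP ord0 i) => [j|] ->; first by rewrite tnthS.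
by rewrite tnth0 meval1.
Qed.

Lemma semialg_set_cube (N : nat) (x : 'rV[R]_n) :
  quad_module g (@ball_poly R n N) -> semialg_set g x -> forall i, `|x 0 i| <= N.+1%:R.
Proof.
move=> [s [S bE]] xS i.
have : 0 <= (@ball_poly R n N).@[x 0].
  apply: (quad_module_le_ge0 (a := (\max_i tdeg (s i * tnth (gext g) i))%:R)) xS.
  by exists s; split=> // j; rewrite ler_nat; apply: leq_bigmax.
have sumE : (\sum_(j < n) 'X_j ^+ 2 : {mpoly R[n]}).@[x 0] = \sum_j x 0 j ^+ 2.
  by rewrite raddf_sum; apply: eq_bigr => j _; rewrite /= rmorphXn /= mevalXU.
rewrite mevalB -mpolyC_nat mevalC sumE subr_ge0 => xN.
rewrite -ler_sqr ?nnegrE // real_normK ?num_real //.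
apply: (@le_trans _ _ (N%:R)).
  apply: le_trans xN; rewrite (bigD1 i) //= lerDl.
  by apply: sumr_ge0 => j _; rewrite sqr_ge0.
by rewrite -natrX ler_nat (leq_trans (leqnSn N)) // -{1}[N.+1]expn1 leq_pexp2l.
Qed.

(** Bernoulli's inequality gives [(1 + K h) (1 - h) ^ K <= 1] for [0 <= h <= 1]. *)
Lemma peak_le (h : R) (K : nat) : (0 < K)%N -> `|h| <= 1 ->
  h * (1 - h) ^+ K.*2 <= K.*2%:R^-1.
Proof.
move=> K0 /[!ler_norml] /andP[h1 h2].
have K2 : 0 < K.*2%:R :> R by rewrite ltr0n double_gt0.
have [h0|h0] := leP 0 h; last first.
  apply: le_trans (_ : 0 <= _); last by rewrite invr_ge0 ltW.
  by rewrite mulr_le0_ge0 ?(ltW h0) // exprn_ge0 // subr_ge0.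
have B (k : nat) : (1 + k%:R * h) * (1 - h) ^+ k <= 1.
  elim: k => [|k IHk]; first by rewrite mul0r addr0 mulr1.
  apply: le_trans IHk; rewrite exprS mulrA ler_wpM2r //.
    by rewrite exprn_ge0 // subr_ge0.
  rewrite -natr1; have := ler0n R k; have := sqr_ge0 h; nra.
have p0 : 0 <= (1 - h) ^+ K.*2 by rewrite exprn_ge0 // subr_ge0.
rewrite -[leRHS]mul1r ler_pdivlMr //; have := B K.*2; nra.
Qed.

Lemma dip_le (h : R) (K : nat) : h <= 0 -> h * (1 - h) ^+ K <= h.
Proof.
move=> h0; have : 1 <= (1 - h) ^+ K by rewrite exprn_ege1 // lerBrDr gerDl.
nra.
Qed.

(** The exponent is even, so that each term is a square times a constraint. Since
    [1 - h] is below [1] for [h > 0] and above [1] for [h < 0], the power damps the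
    terms of the satisfied constraints only. *)
Definition penalty (G : R) (k : nat) : {mpoly R[n]} :=
  \sum_i (G^-1 *: tnth g i) * (1 - G^-1 *: tnth g i) ^+ k.*2.

Variables (r t0 : R) (L : nat) (t0_gt0 : 0 < t0).
Hypothesis S_cube : forall x, semialg_set g x -> forall i, `|x 0 i| <= r.
Hypothesis lojaP : forall t (x : 'rV[R]_n), 0 < t < t0 -> (forall i, `|x 0 i| <= r) ->
    (forall y : 'rV[R]_n, semialg_set g y -> t <= \sum_i (x 0 i - y 0 i) ^+ 2) ->
    exists i, (tnth g i).@[x 0] <= - t ^+ L.

Lemma constraints_bounded : exists2 G, 0 < G &
  forall (v : 'I_n -> R), (forall i, `|v i| <= r) ->
    forall i, `|G^-1 * (tnth g i).@[v]| <= 1.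
Proof.
have [B BP] := choice (fun i => let: ex_intro2 F F0 FP := meval_cube_lip r (tnth g i) in
  ex_intro (fun F => 0 < F /\ forall v : 'I_n -> R, (forall j, `|v j| <= r) ->
     `|(tnth g i).@[v]| <= F) F (conj F0 (fun v vr => (FP v vr).1))).
have B0 i : 0 <= B i by rewrite ltW //; have [] := BP i.
have G0 : 0 < 1 + \sum_i B i by rewrite ltr_pwDl // sumr_ge0.
exists (1 + \sum_i B i) => // v vr i; rewrite normrM gtr0_norm ?invr_gt0 //.
rewrite mulrC ler_pdivrMr // mul1r; have [_ /(_ v vr) le_B] := BP i.
by apply: le_trans le_B _; rewrite (bigD1 i) //= addrCA lerDl addr_ge0 // sumr_ge0.
Qed.

Lemma penalty_eval G k (v : 'I_n -> R) : (penalty G k).@[v] =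
  \sum_i (G^-1 * (tnth g i).@[v]) * (1 - G^-1 * (tnth g i).@[v]) ^+ k.*2.
Proof.
rewrite /penalty raddf_sum; apply: eq_bigr => i _ /=.
by rewrite mevalM rmorphXn /= mevalB meval1 mevalZ.
Qed.

(** Where [f] exceeds [fstar - eps / 2] the penalty is too small to matter.
    Elsewhere the distance to the feasible set is at least a multiple of [eps],
    so the Lojasiewicz inequality makes some constraint negative enough for the
    penalty to compensate for all of [f]. *)
Lemma penalty_positive f (fstar : R) : is_min_on (semialg_set g) f fstar ->
  exists G C, [/\ 0 < G, 0 < C & forall u k, 1 <= u -> (0 < k)%N ->
    2 * m%:R * (C * u ^+ L.*2.+1) <= k%:R ->
    forall v : 'I_n -> R, (forall i, `|v i| <= r) ->
      u^-1 / 4 <= (f - (fstar - u^-1)%:MP - (C * u ^+ L.*2) *: penalty G k).@[v]].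
Proof.
move=> [[x0 x0S fx0] f_ge]; have [G G0 GP] := constraints_bounded.
have [F0 F0_gt0 F0P] := meval_cube_lip r f.
have it0 : 0 < t0^-1 by rewrite invr_gt0.
have [F [F1 F_F0 F_t0]] : exists F, [/\ 1 <= F, F0 <= F & t0^-1 <= F].
  by exists (F0 + 1 + t0^-1); split; lra.
have F_gt0 : 0 < F := lt_le_trans ltr01 F1.
have F2 : 0 < 2 * F by rewrite mulr_gt0.
have halfE e : e / 2 = F * (e / (2 * F)) by field; rewrite gt_eqF.
have C0 : 0 < (2 * F + 1) * G * (2 * F) ^+ L.*2.
  by rewrite !mulr_gt0 ?exprn_gt0 ?addr_gt0.
exists G, ((2 * F + 1) * G * (2 * F) ^+ L.*2); split=> //.
(* [C] makes [C u^(2L)] times the violation given by the Lojasiewicz inequality,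
   [G^-1 (eps / 2 F)^(2L)], equal to [2 F + 1], which exceeds [fstar - f] on the cube. *)
set C := (X in 0 < X) in C0 *; move=> u k u1 k0 k_ge v vr.
have u0 : 0 < u := lt_le_trans ltr01 u1.
set eps := u^-1; have eps0 : 0 < eps by rewrite invr_gt0.
have eps1 : eps <= 1 by rewrite invf_le1.
pose x : 'rV[R]_n := \row_i v i.
have xE : x 0 = v by apply/funext => i; rewrite mxE.
rewrite !mevalB mevalC mevalZ penalty_eval.
set h := fun i => G^-1 * (tnth g i).@[v].
rewrite -/(h _); set lam := C * u ^+ L.*2.
have lam0 : 0 < lam by rewrite mulr_gt0 // exprn_gt0.
have beta (i : 'I_m) : h i * (1 - h i) ^+ k.*2 <= k.*2%:R^-1 by apply: peak_le => //; apply: GP.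
have k2 : 0 < k.*2%:R :> R by rewrite ltr0n double_gt0.
have le_beta : lam * (m%:R * k.*2%:R^-1) <= eps / 4.
  rewrite mulrA ler_pdivrMr // -mul2n natrM.
  have -> : lam * m%:R = eps / 4 * (2 * (2 * m%:R * (C * u ^+ L.*2.+1))).
    by rewrite /lam /eps exprSr; field; rewrite gt_eqF.
  by rewrite ler_pM2l ?divr_gt0 // ler_pM2l.
have [fv|fv] := leP (fstar - eps / 2) f.@[v].
  have : lam * \sum_i h i * (1 - h i) ^+ k.*2 <= eps / 4.
    apply: le_trans le_beta; rewrite ler_pM2l // mulr_natl.
    by rewrite -[X in _ *+ X]card_ord -sumr_const; apply: ler_sum.
  by move: fv; lra.
(* Within distance [eps / 2 F], [f] varies by at most [eps / 2]. *)
have far : forall y : 'rV[R]_n, semialg_set g y ->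
    (eps / (2 * F)) ^+ 2 <= \sum_i (x 0 i - y 0 i) ^+ 2.
  move=> y yS; rewrite leNgt; apply/negP => xy.
  have d0 : 0 <= eps / (2 * F) by rewrite divr_ge0 // ltW.
  have close i : `|v i - y 0 i| <= eps / (2 * F).
    rewrite -ler_sqr ?nnegrE // real_normK ?num_real // (le_trans _ (ltW xy)) //.
    rewrite (bigD1 i) //= xE lerDl; apply: sumr_ge0 => j _; exact: sqr_ge0.
  have := (F0P v vr).2 (y 0) _ (S_cube yS) close d0.
  have : F0 * (eps / (2 * F)) <= eps / 2.
    rewrite (halfE eps); exact: ler_wpM2r.
  have := f_ge y yS; rewrite ler_norml; move: fv => ? ? ? /andP[]; lra.
have t_lt : 0 < (eps / (2 * F)) ^+ 2 < t0.
  rewrite exprn_gt0 ?divr_gt0 //=.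
  apply: le_lt_trans (_ : (2 * F)^-1 < _); last first.
    by rewrite -[t0]invrK ltf_pV2 ?posrE //; lra.
  have iF1 : (2 * F)^-1 <= 1 by rewrite invf_le1 //; lra.
  have iF0 : 0 < (2 * F)^-1 by rewrite invr_gt0.
  rewrite exprMn -[leRHS]mul1r ler_pM ?sqr_ge0 //; first by rewrite exprn_ile1 // ltW.
  by rewrite expr2 ler_piMr // ltW.
have [|i0 gi0] := lojaP t_lt _ far; first by move=> i; rewrite xE.
rewrite xE in gi0.
have hi0 : lam * h i0 <= - (2 * F + 1).
  have -> : 2 * F + 1 = lam * (G^-1 * ((eps / (2 * F)) ^+ 2) ^+ L).
    rewrite -exprM mul2n /lam /C /eps [(u^-1 / _) ^+ _]exprMn !exprVn.
    have a0 : (2 * F) ^+ L.*2 != 0 by rewrite expf_neq0 // gt_eqF.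
    have b0 : u ^+ L.*2 != 0 by rewrite expf_neq0 // gt_eqF.
    by move: a0 b0; set a := (2 * F) ^+ _; set b := u ^+ _ => *; field;
      do ?[apply/andP; split] => //; rewrite gt_eqF.
  by rewrite -mulrN -mulrN ler_pM2l // /h ler_pM2l ?invr_gt0.
have hi0_le0 : h i0 <= 0.
  by rewrite -(pmulr_rle0 _ lam0) (le_trans hi0) // oppr_le0; lra.
have : lam * \sum_i h i * (1 - h i) ^+ k.*2 <= - (2 * F + 1) + eps / 4.
  rewrite (bigD1 i0) //= mulrDr; apply: lerD.
    by apply: le_trans hi0; rewrite ler_pM2l // dip_le.
  apply: le_trans le_beta; rewrite ler_pM2l // mulr_natl.
  rewrite -[X in _ *+ X]card_ord -sumr_const [leRHS](bigD1 i0) //=.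
  by rewrite ler_wpDl ?invr_ge0 // ler_sum.
have := (F0P v vr).1; have := (F0P (x0 0) (S_cube x0S)).1.
by rewrite fx0 !ler_norml => /andP[? ?] /andP[? ?]; lra.
Qed.

End Perturbation.

(** * The degree of the certificate *)

Section ExponentialBounds.
Variables (R : realType) (e : nat) (e_gt0 : (0 < e)%N).
Implicit Types (h : R -> R).

(** A property of functions of [u], so that the constant is uniform in [u]. *)
Definition exp_bounded h : Prop :=
  exists2 C, 0 < C & forall u, 1 <= u -> 0 <= h u <= expR (C * u ^+ e).

Lemma exp_boundedW h1 h2 : exp_bounded h2 ->
  (forall u, 1 <= u -> 0 <= h1 u <= h2 u) -> exp_bounded h1.
Proof.
move=> [C C0 h2C] h12; exists C => // u u1.
have /andP[-> le12] := h12 u u1; have /andP[_ le2] := h2C u u1.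
exact: le_trans le2.
Qed.

Lemma exp_bounded_linear (c : R) : 0 <= c -> exp_bounded (fun u => c * u ^+ e).
Proof.
move=> c0; exists (c + 1); first by rewrite ltr_wpDl.
move=> u u1; have U0 : 0 <= u ^+ e by rewrite exprn_ge0 // (le_trans ler01).
rewrite mulr_ge0 //=; apply: le_trans (_ : (c + 1) * u ^+ e <= _).
  by rewrite ler_wpM2r // lerDl.
by apply: le_trans (expR_ge1Dx _); rewrite lerDr.
Qed.

Lemma exp_bounded_const (c : R) : 0 <= c -> exp_bounded (fun=> c).
Proof.
move=> c0; apply: exp_boundedW (exp_bounded_linear c0) _ => u u1.
by rewrite c0 ler_peMr // exprn_ege1.
Qed.

Lemma exp_bounded_id : exp_bounded id.
Proof.
apply: exp_boundedW (exp_bounded_linear ler01) _ => u u1.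
by rewrite (le_trans ler01) //= mul1r ler_eXnr.
Qed.

Lemma exp_boundedM h1 h2 : exp_bounded h1 -> exp_bounded h2 ->
  exp_bounded (fun u => h1 u * h2 u).
Proof.
move=> [C1 C10 hC1] [C2 C20 hC2]; exists (C1 + C2); first exact: addr_gt0.
move=> u u1; have /andP[a0 aC] := hC1 u u1; have /andP[b0 bC] := hC2 u u1.
by rewrite mulr_ge0 //= mulrDl expRD ler_pM.
Qed.

Lemma exp_boundedD h1 h2 : exp_bounded h1 -> exp_bounded h2 ->
  exp_bounded (fun u => h1 u + h2 u).
Proof.
move=> [C1 C10 hC1] [C2 C20 hC2].
exists (C1 + C2 + 1); first by rewrite !addr_gt0.
move=> u u1; have /andP[a0 aC] := hC1 u u1; have /andP[b0 bC] := hC2 u u1.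
have U1 : 1 <= u ^+ e by rewrite exprn_ege1.
have U0 : 0 <= u ^+ e by rewrite (le_trans ler01).
have E1 (c : R) : 0 < c -> 1 <= expR (c * u ^+ e).
  by move=> c0; rewrite (le_trans _ (expR_ge1Dx _)) // lerDl mulr_ge0 // ltW.
have E2 : 2 <= expR (1 * u ^+ e) :> R.
  by rewrite mul1r (le_trans _ (expR_ge1Dx _)) //; lra.
rewrite addr_ge0 //= !mulrDl !expRD.
have := E1 _ C10; have := E1 _ C20; move: (expR (C1 * _)) (expR (C2 * _)) aC bC E2.
move: (expR (1 * _)) => c x y ax bx c2 y1 x1.
apply: le_trans (_ : x * y * 2 <= _); first by nra.
by rewrite ler_wpM2l // mulr_ge0 // (le_trans ler01).
Qed.

Lemma exp_boundedX (B c : R) (k : R -> nat) : 0 <= B -> 0 <= c ->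
  (forall u, 1 <= u -> (k u)%:R <= c * u ^+ e) -> exp_bounded (fun u => B ^+ k u).
Proof.
move=> B0 c0 kc; exists (B * c + 1); first by rewrite ltr_wpDl // mulr_ge0.
move=> u u1; rewrite exprn_ge0 //=.
apply: le_trans (_ : expR B ^+ k u <= _).
  by rewrite lerXn2r ?nnegrE ?expR_ge0 // (le_trans _ (expR_ge1Dx _)) // lerDr.
rewrite -expRM_natl ler_expR.
apply: le_trans (_ : (B * c) * u ^+ e <= _).
  by rewrite mulrC -mulrA ler_wpM2l // kc.
by rewrite ler_wpM2r ?lerDl // exprn_ge0 // (le_trans ler01).
Qed.

Lemma exp_boundedDn (a b : R -> nat) : exp_bounded (fun u => (a u)%:R) ->
  exp_bounded (fun u => (b u)%:R) -> exp_bounded (fun u => (a u + b u)%:R).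
Proof.
move=> aE bE; apply: exp_boundedW (exp_boundedD aE bE) _ => u _.
by rewrite natrD addr_ge0 /=.
Qed.

Lemma exp_boundedMn (a b : R -> nat) : exp_bounded (fun u => (a u)%:R) ->
  exp_bounded (fun u => (b u)%:R) -> exp_bounded (fun u => (a u * b u)%:R).
Proof.
move=> aE bE; apply: exp_boundedW (exp_boundedM aE bE) _ => u _.
by rewrite natrM mulr_ge0 /=.
Qed.

End ExponentialBounds.

Section PutinarBound.
Variables (R : realType) (n m : nat) (g : m.-tuple {mpoly R[n]}).
Hypothesis g_arch : archimedean_qm g.

Lemma coef_bound_sum (I : Type) (r : seq I) (F : I -> {mpoly R[n]}) A D :
  0 <= A -> (forall i, coef_bound A D (F i)) ->
  coef_bound ((size r)%:R * A) D (\sum_(i <- r) F i).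
Proof.
move=> A0 FA; elim: r => [|i r IHr].
  rewrite big_nil mul0r -mpolyC0; apply: coef_boundW (coef_boundC n 0) => //.
  by rewrite normr0.
by rewrite big_cons -nat1r mulrDl mul1r -[D]maxnn; apply: coef_boundD.
Qed.

Lemma coef_bound_family (F : 'I_m -> {mpoly R[n]}) : exists B D,
  1 <= B /\ forall i, coef_bound B D (F i).
Proof.
have [A AP] := choice (fun i => coef_bound_exists (F i)).
have [D DP] := choice AP.
exists (1 + \sum_i A i), (\sum_i D i)%N.
have A0 i : 0 <= A i := coef_bound_ge0 (DP i).
split=> [|i]; first by rewrite lerDl sumr_ge0.
apply: coef_boundW (DP i); last by rewrite (bigD1 i) //= leq_addr.
by rewrite (bigD1 i) //= addrCA lerDl addr_ge0 // sumr_ge0.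
Qed.

Lemma penalty_module (G lam : R) (k : nat) : 0 < G -> 0 <= lam ->
  let dg := (\sum_i tdeg (tnth g i))%N in
  quad_module_le g (k.*2 * dg + dg)%:R (lam *: penalty g G k).
Proof.
move=> G0 lam0 dg; rewrite scaler_sumr; apply: quad_module_le_sum => // i.
have gi : (tdeg (tnth g i) <= dg)%N by rewrite /dg (bigD1 i) //= leq_addr.
have -> : lam *: (G^-1 *: tnth g i * (1 - G^-1 *: tnth g i) ^+ k.*2) =
    (lam * G^-1)%:MP * (1 - G^-1 *: tnth g i) ^+ k.*2 * tnth g i.
  by rewrite -scalerAl scalerA -mulrA mul_mpolyC [tnth g i * _]mulrC.
have pd : (tdeg ((lam * G^-1)%:MP * (1 - G^-1 *: tnth g i) ^+ k.*2) <= k.*2 * dg)%N.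
  rewrite -[(_ * dg)%N]add0n tdegM_le ?tdegC //; apply: tdegX_le.
  apply: tdegD_le; first by rewrite -mpolyC1 tdegC.
  by rewrite /tdeg msizeN -mul_mpolyC -[dg]add0n; apply: tdegM_le; rewrite ?tdegC.
apply: quad_module_le_gen; last exact: tdegM_le.
apply: sosM; first by apply: sosC; rewrite mulr_ge0 // invr_ge0 ltW.
by rewrite -muln2 exprM; apply: sos_sqr.
Qed.

(** The exponent comes from the Lojasiewicz inequality and depends on [g] only;
    [f] enters through the constant [C]. The degree is exponential because the
    coefficients of [penalty g G k] are exponential in [k], which is a polynomial
    in [u]. *)
Theorem putinar_exp_bound : exists2 e : nat, (0 < e)%N &
  forall f (fstar : R), is_min_on (semialg_set g) f fstar ->
  exists2 C : R, 0 < C & forall u, 1 <= u -> exists2 d : nat,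
    d%:R <= expR (C * u ^+ e) & quad_module_le g d%:R (f - (fstar - u^-1)%:MP).
Proof.
have [N ballM] := g_arch; have [d0 d0P] := principal_module_quad ballM.
pose r : R := N.+1%:R; have r0 : 0 < r by rewrite ltr0n.
have Nr : N%:R <= r ^+ 2.
  by rewrite -natrX ler_nat (leq_trans (leqnSn N)) // -{1}[N.+1]expn1 leq_pexp2l.
have [L [t0 [t0_gt0 lojaP]]] := lojasiewicz g r.
exists L.*2.+1 => // f fstar fmin; set e := L.*2.+1.
have S_cube x (xS : semialg_set g x) := semialg_set_cube ballM xS.
have [G [C [G0 C0 posP]]] := penalty_positive t0_gt0 S_cube lojaP fmin.
have [B1 [D1 [B1_ge1 B1P]]] :=
  coef_bound_family (fun i => (G^-1 *: tnth g i) \mPo cube_scale n r).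
have [B2 [D2 [B2_ge1 B2P]]] :=
  coef_bound_family (fun i => (1 - G^-1 *: tnth g i) \mPo cube_scale n r).
have [Af [Df fA]] := coef_bound_exists (f \mPo cube_scale n r).
have Af0 := coef_bound_ge0 fA.
have B10 : 0 <= B1 by rewrite (le_trans ler01).
have B20 : 0 <= B2 by rewrite (le_trans ler01).
(* [k] is the least allowed by [penalty_positive], up to rounding. *)
pose c1 := 2 * m%:R * C; have c10 : 0 <= c1 by rewrite !mulr_ge0 // ltW.
pose k (u : R) := (Num.truncn (c1 * u ^+ e)).+1.
pose A (u : R) := Af + (`|fstar| + 1) + C * u ^+ L.*2 * (m%:R * (B1 * B2 ^+ (k u).*2)).
pose D (u : R) := (Df + (D1 + (k u).*2 * D2))%N.
(* [A u] and [D u] bound the coefficients and the degree of the polynomial to be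
   certified; [K u] is the resulting degree of its Bernstein expansion. *)
pose X (u : R) := 4 * u * (A u * (D u * D u)%:R).
pose K (u : R) := ((Num.truncn (X u)).+1 + D u)%N.
pose dg := (\sum_i tdeg (tnth g i))%N.
pose d (u : R) := (n * (K u * 6 + 8) + d0 + ((k u).*2 * dg + dg))%N.
have U0 (u : R) : 1 <= u -> 0 <= u ^+ e.
  by move=> u1; rewrite exprn_ge0 // (le_trans ler01).
have A0 (u : R) : 1 <= u -> 0 <= A u.
  move=> u1; have u0 : 0 <= u := le_trans ler01 u1.
  apply: addr_ge0; first by rewrite addr_ge0 // addr_ge0.
  apply: mulr_ge0; first by apply: mulr_ge0; [exact: ltW | exact: exprn_ge0].
  by apply: mulr_ge0 => //; apply: mulr_ge0 => //; apply: exprn_ge0.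
have X0 (u : R) : 1 <= u -> 0 <= X u.
  by move=> u1; rewrite !mulr_ge0 ?A0 // (le_trans ler01).
have k_ge (u : R) : 1 <= u -> c1 * u ^+ e <= (k u)%:R.
  by move=> u1; rewrite ltW // truncnS_gt.
have k_le (u : R) : 1 <= u -> (k u)%:R <= (c1 + 1) * u ^+ e.
  move=> u1; rewrite /k -natr1 mulrDl mul1r lerD ?exprn_ege1 //.
  by rewrite truncn_le mulr_ge0 ?U0.
have [Cd Cd0 dP] : exp_bounded e (fun u => (d u)%:R).
  have natE (a : nat) : exp_bounded e (fun _ : R => a%:R) by apply: exp_bounded_const.
  have c11 : 0 <= c1 + 1 by rewrite addr_ge0.
  have kE : exp_bounded e (fun u => (k u)%:R).
    by apply: exp_boundedW (exp_bounded_linear e c11) _ => u u1; rewrite ler0n k_le.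
  have k2E : exp_bounded e (fun u => (k u).*2%:R).
    have -> : (fun u => (k u).*2%:R) = (fun u => (k u + k u)%:R :> R).
      by apply/funext => u; rewrite addnn.
    exact: exp_boundedDn.
  have DE : exp_bounded e (fun u => (D u)%:R).
    by apply: exp_boundedDn => //; apply: exp_boundedDn => //; apply: exp_boundedMn.
  have AE : exp_bounded e A.
    apply: exp_boundedD; first by apply: exp_bounded_const => //; rewrite !addr_ge0.
    apply: exp_boundedM.
      apply: exp_boundedW (exp_bounded_linear e (ltW C0)) _ => u u1.
      rewrite mulr_ge0 ?exprn_ge0 ?(ltW C0) ?(le_trans ler01) //=.
      by rewrite ler_pM2l // ler_weXn2l.
    apply: exp_boundedM => //; apply: exp_boundedM; first exact: exp_bounded_const.
    apply: (exp_boundedX (c := 2 * (c1 + 1))) => //; first by rewrite mulr_ge0.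
    by move=> u u1; rewrite -mul2n natrM -mulrA ler_pM2l // k_le.
  have XE : exp_bounded e X.
    apply: exp_boundedM; last by apply: exp_boundedM => //; apply: exp_boundedMn.
    by apply: exp_boundedM => //; apply: exp_bounded_id.
  have KE : exp_bounded e (fun u => (K u)%:R).
    apply: exp_boundedDn => //; apply: exp_boundedW (exp_boundedD XE (natE 1%N)) _.
    by move=> u u1; rewrite ler0n -natr1 lerD2r truncn_le X0.
  apply: exp_boundedDn; apply: exp_boundedDn => //; apply: exp_boundedMn => //.
  by apply: exp_boundedDn => //; apply: exp_boundedMn.
exists Cd => // u u1; exists (d u); first by have /andP[] := dP u u1.
have u0 : 0 < u := lt_le_trans ltr01 u1.
have iu1 : u^-1 <= 1 by rewrite invf_le1.
have iu0 : 0 < u^-1 by rewrite invr_gt0.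
have lam0 : 0 <= C * u ^+ L.*2 by rewrite mulr_ge0 ?exprn_ge0 // ltW.
set c := fstar - u^-1; set lam := C * u ^+ L.*2 in lam0 *.
rewrite -[f - _](subrK (lam *: penalty g G (k u))).
apply: quad_module_leD; last first.
  apply: quad_module_leW (penalty_module _ G0 lam0).
  by rewrite ler_nat leq_addl.
apply: quad_module_leW (_ : (n * (K u * 6 + 8) + d0)%:R <= _) _.
  by rewrite ler_nat leq_addr.
apply: d0P; apply: (ball_certificate (A := A u) (D := D u) (eta := u^-1 / 4) r0 Nr).
- have -> : (f - c%:MP - lam *: penalty g G (k u)) \mPo cube_scale n r =
      f \mPo cube_scale n r + (- c)%:MP + (- lam) *: \sum_i
      (((G^-1 *: tnth g i) \mPo cube_scale n r) *
       ((1 - G^-1 *: tnth g i) \mPo cube_scale n r) ^+ (k u).*2).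
    rewrite !comp_mpolyB comp_mpolyC comp_mpolyZ mpolyCN scaleNr.
    congr (_ - _ *: _); rewrite /penalty raddf_sum; apply: eq_bigr => i _.
    by rewrite [LHS]rmorphM /= rmorphXn.
  have BX : 0 <= B1 * B2 ^+ (k u).*2 by rewrite mulr_ge0 // exprn_ge0.
  have pen := coef_bound_sum (index_enum 'I_m) BX
    (fun i => coef_boundM (B1P i) (coef_boundX (k u).*2 (B2P i))).
  have := coef_boundD (coef_boundD fA (coef_boundC n (- c))) (coef_boundZ (- lam) pen).
  have -> : size (index_enum 'I_m) = m.
    by rewrite -sum1_size big_const_ord iter_addn_0 mul1n.
  apply: coef_boundW; last by rewrite maxn0 geq_max leq_addr leq_addl.
  rewrite !normrN (ger0_norm lam0) lerD2r lerD2l.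
  by rewrite (le_trans (ler_normB _ _)) // lerD2l gtr0_norm.
- by rewrite /K addSn.
- exact: leq_addl.
- by apply: posP => //; rewrite mulrA; apply: k_ge.
- have X_le : X u <= (K u)%:R.
    apply: le_trans (ltW (truncnS_gt _)) _; by rewrite ler_nat leq_addr.
  rewrite ler_pdivrMr; last by rewrite ltr0n /K addSn.
  have -> : A u * (D u * D u)%:R = u^-1 / 4 * X u.
    by rewrite /X; field; rewrite gt_eqF.
  by rewrite ler_wpM2l // ltW // divr_gt0.
Qed.

End PutinarBound.

(** * The convergence rate *)

Lemma semialg_min_exists (R : realType) (n m : nat) (g : m.-tuple {mpoly R[n]})
    (f : {mpoly R[n]}) : archimedean_qm g -> semialg_set g !=set0 ->
  exists fstar, is_min_on (semialg_set g) f fstar.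
Proof.
move=> [N ballM] S0.
have S_compact : compact (semialg_set g).
  apply: subclosed_compact (@semialg_set_closed R n m g) (@cube_compact R n N.+1%:R) _.
  by move=> x xS i; apply: semialg_set_cube ballM xS i.
have [x xS x_min] := @EVT_min_rV R n (fun x => f.@[x 0]) _ S0 S_compact
  (continuous_subspaceT (@meval_continuous R n f)).
exists f.@[x 0]; split; first by exists x => //; exact: set_mem.
by move=> y yS; apply: x_min; apply: mem_set.
Qed.

Lemma relax_opt_bounds (R : realType) (n m : nat) (g : m.-tuple {mpoly R[n]})
    (f : {mpoly R[n]}) (fstar eps k : R) :
  is_min_on (semialg_set g) f fstar -> quad_module_le g k (f - (fstar - eps)%:MP) ->
  (0%:E <= fstar%:E - relax_opt g f k <= eps%:E)%E.
Proof.
move=> [[x xS fx] _] fM.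
have le_f : (relax_opt g f k <= fstar%:E)%E.
  apply: ge_ereal_sup => _ [a aM <-]; rewrite lee_fin -subr_ge0 -fx.
  by have := quad_module_le_ge0 aM xS; rewrite mevalB mevalC.
have ge_f : ((fstar - eps)%:E <= relax_opt g f k)%E.
  by apply: ereal_sup_ubound; exists (fstar - eps).
case: (relax_opt g f k) le_f ge_f => [a| |] //=.
rewrite -EFinB !lee_fin => le_a ge_a; apply/andP; split; lra.
Qed.

Theorem corollary9 (R : realType) (n m : nat) (g : m.-tuple {mpoly R[n]})
    (n_gt0 : (0 < n)%N) (g_arch : archimedean_qm g)
    (S_neq0 : semialg_set g !=set0) :
  exists c : R, 0 < c /\
    forall f : {mpoly R[n]}, exists fstar : R,
      is_min_on (semialg_set g) f fstar /\
      exists c' : R, 0 < c' /\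
        exists k0 : nat, forall k : nat, (k0 <= k)%N ->
          (0%:E <= fstar%:E - relax_opt g f k%:R
             <= (c' / (ln (k%:R / c) `^ c^-1))%:E)%E.
Proof.
have [e e_gt0 putinar] := putinar_exp_bound g_arch.
have c0 : 0 < e%:R :> R by rewrite ltr0n.
have c1 : 1 <= e%:R :> R by rewrite ler1n.
(* With [l = ln (k / e)] and [eps = C' / l^(1/e)], the bound [C u^e] on the
   logarithm of the degree becomes [C l / C'^e <= l]; the threshold on [k] says
   that [eps <= 1]. *)
exists e%:R; split=> // f.
have [fstar fmin] := semialg_min_exists f g_arch S_neq0.
exists fstar; split=> //; have [C C0 CP] := putinar f fstar fmin.
pose C' := Num.max C 1.
have C'1 : 1 <= C' by rewrite le_max lexx orbT.
have C'0 : 0 < C' := lt_le_trans ltr01 C'1.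
have CC' : C <= C' by rewrite le_max lexx.
exists C'; split=> //.
exists (Num.truncn (e%:R * expR (C' ^+ e))).+1 => k k0k.
have k_big : e%:R * expR (C' ^+ e) < k%:R.
  by apply: lt_le_trans (truncnS_gt _) _; rewrite ler_nat.
have k_gt0 : 0 < k%:R :> R.
  by apply: le_lt_trans k_big; rewrite mulr_ge0 ?expR_ge0 // ltW.
have ln_ge : C' ^+ e <= ln (k%:R / e%:R).
  rewrite -[leLHS]expRK ler_ln ?posrE ?expR_gt0 ?divr_gt0 //.
  by rewrite ler_pdivlMr // mulrC ltW.
set l := ln _ in ln_ge *.
have l0 : 0 < l by apply: lt_le_trans ln_ge; rewrite exprn_gt0.
pose w := l `^ e%:R^-1; have w0 : 0 < w by rewrite powR_gt0.
have wX : w ^+ e = l.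
  by rewrite -powR_mulrn ?powR_ge0 // -powRrM mulVf ?gt_eqF // powRr1 // ltW.
have u1 : 1 <= w / C'.
  rewrite ler_pdivlMr // mul1r -(ler_pXn2r e_gt0) ?nnegrE ?(ltW w0) ?(ltW C'0) //.
  by rewrite wX.
have [d d_le dM] := CP _ u1.
rewrite -/w -invf_div; apply: relax_opt_bounds fmin _.
apply: quad_module_leW dM; apply: le_trans d_le _.
apply: le_trans (_ : expR l <= _); last first.
  by rewrite lnK ?posrE ?divr_gt0 // ler_pdivrMr // ler_peMr // ltW.
rewrite ler_expR expr_div_n wX mulrCA -[leRHS]mulr1 ler_pM2l //.
rewrite ler_pdivrMr ?exprn_gt0 // mul1r (le_trans CC') //.
by rewrite ler_eXnr.
Qed.
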